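(* There exists an absolute constant $\mathcal{Q}>0$ such that the following is true. Let $\mathbf{K}$ be a field with odd characteristic. Let $E$ be an elliptic curve over $\mathbf{K}$, given by a Weierstrass equation. Let $\delta\geqslant 1$ be an integer. Let $t$ be a point of order $d=2^\delta$ in $E(\mathbf{K})$. Let $b$ be a point in $E(\mathbf{K})$ such that $db\neq O$. There exists a straight-line program that, on input a function $f\in\mathcal{L}(\langle t\rangle)$ given by its coordinates in either of the bases $u=(u_l)_{l\in\mathbf{Z}/d\mathbf{Z}}$ or $v=(v_l)_{l\in\mathbf{Z}/d\mathbf{Z}}$ of $\mathcal{L}(\langle t\rangle)$, computes the values $f(b+lt)$ for $l\in[0,d-1]$ at the expense of at most $\mathcal{Q}\,d\log(d)$ operations in $\mathbf{K}$.
   Context: **Curve and functions.** $E$ is given by $Y^2Z+a_1XYZ+a_3YZ^2=X^3+a_2X^2Z+a_4XZ^2+a_6Z^3$ over $\mathbf{K}$, with $O=(0:1:0)$ the point at infinity (the neutral element), and $x=X/Z$, $y=Y/Z$. For a point $A$ on $E$, $\tau_A$ denotes the translation by $A$, and $x_A=x\circ\tau_{-A}$, $y_A=y\circ\tau_{-A}$. For two distinct points $A,B$ on $E$, $$u_{A,B}=\frac{y_A-y(A-B)}{x_A-x(A-B)},$$ a function on $E$ with polar divisor $[A]+[B]$. **The space.** $\langle t\rangle$ is the group generated by $t$, also seen as the effective divisor $\sum_{0\leqslant l\leqslant d-1}[lt]$ of degree $d$ on $E$; $\mathcal{L}(\langle t\rangle)$ is the associated $\mathbf{K}$-linear (Riemann–Roch)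 space, of dimension $d$. **The bases.** The sum $\mathfrak{a}=\sum_{l\in\mathbf{Z}/d\mathbf{Z}}u_{lt,(l+1)t}$ is a constant in $\mathbf{K}$. For $l\in\mathbf{Z}/d\mathbf{Z}$ set $u_l=u_{lt,(l+1)t}+(1-\mathfrak{a})/d$. Set $v_0=1$ and $v_l=u_{O,lt}$ for $l\neq 0\bmod d$. Both $u=(u_l)_{l\in\mathbf{Z}/d\mathbf{Z}}$ and $v=(v_l)_{l\in\mathbf{Z}/d\mathbf{Z}}$ are bases of $\mathcal{L}(\langle t\rangle)$. **Straight-line programs.** A straight-line program over $\mathbf{K}$ is a finite sequence of operations, without loops or conditionals, involving the inputs, precomputed constants in $\mathbf{K}$ (which may depend on $\mathbf{K},E,t,b$ but not on the input), and previously computed elements; here the operations are additions and multiplications by precomputed constants in $\mathbf{K}$. Its complexity is the number of operations. Precomputation of constants is not counted. *)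

(* Defs.v *)
From HB Require Import structures.
From mathcomp Require Import all_boot all_order all_algebra all_field.
From mathcomp Require Import qpoly qfpoly fraction generic_quotient zify ring.

Set Implicit Arguments.
Unset Strict Implicit.
Unset Printing Implicit Defensive.

Import Order.TTheory GRing.Theory Num.Theory.
Local Open Scope ring_scope.

(* The equation Y^2 Z + a1 XYZ + a3 YZ^2 = X^3 + a2 X^2 Z + a4 XZ^2 + a6 Z^3. *)
Record weierstrass (F : Type) := Weierstrass
  { a1 : F; a2 : F; a3 : F; a4 : F; a6 : F }.

Definition map_curve (F L : Type) (phi : F -> L) (E : weierstrass F) :=
  Weierstrass (phi (a1 E)) (phi (a2 E)) (phi (a3 E)) (phi (a4 E)) (phi (a6 E)).

(* None is the point at infinity O = (0 : 1 : 0), Some (x, y) is (x : y : 1). *)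
Definition point (F : Type) := option (F * F).

Definition map_point (F L : Type) (phi : F -> L) : point F -> point L :=
  omap (fun P => (phi P.1, phi P.2)).

Section GroupLaw.
Variables (F : fieldType) (E : weierstrass F).

Definition discriminant : F :=
  let b2 := a1 E ^+ 2 + 4 * a2 E in
  let b4 := 2 * a4 E + a1 E * a3 E in
  let b6 := a3 E ^+ 2 + 4 * a6 E in
  let b8 := a1 E ^+ 2 * a6 E + 4 * a2 E * a6 E - a1 E * a3 E * a4 E
            + a2 E * a3 E ^+ 2 - a4 E ^+ 2 in
  - b2 ^+ 2 * b8 - 8 * b4 ^+ 3 - 27 * b6 ^+ 2 + 9 * b2 * b4 * b6.

Definition on_curve (P : point F) : bool :=
  if P is Some (x, y) then
    y ^+ 2 + a1 E * x * y + a3 E * y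
      == x ^+ 3 + a2 E * x ^+ 2 + a4 E * x + a6 E
  else true.

Definition popp (P : point F) : point F :=
  if P is Some (x, y) then Some (x, - y - a1 E * x - a3 E) else None.

Definition padd (P Q : point F) : point F :=
  match P, Q with
  | None, _ => Q
  | _, None => P
  | Some (x1, y1), Some (x2, y2) =>
    if Q == popp P then None else
    let lam := if x1 == x2
               then (3 * x1 ^+ 2 + 2 * a2 E * x1 + a4 E - a1 E * y1)
                    / (2 * y1 + a1 E * x1 + a3 E)
               else (y2 - y1) / (x2 - x1) in
    let x3 := lam ^+ 2 + a1 E * lam - a2 E - x1 - x2 in
    Some (x3, lam * (x1 - x3) - y1 - a1 E * x3 - a3 E)
  end.

Definition psub (P Q : point F) : point F := padd P (popp Q).

Definition pmul (n : nat) (P : point F) : point F := iter n (padd P) None.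

Definition has_order (P : point F) (d : nat) : Prop :=
  [/\ (0 < d)%N, pmul d P = None &
      forall m, (0 < m < d)%N -> pmul m P <> None].

(* The coordinates of O are a dummy value. *)
Definition xcoord (P : point F) : F := if P is Some (x, _) then x else 0.
Definition ycoord (P : point F) : F := if P is Some (_, y) then y else 0.

Definition proj_coords (P : point F) : F * F * F :=
  if P is Some (x, y) then (x, y, 1) else (0, 1, 0).

End GroupLaw.

Section FunctionField.
Variables (K : fieldType) (E : weierstrass K).

(* The affine equation of E, as a monic polynomial in y over K(x). *)
Definition weierstrass_poly : {poly {fraction {poly K}}} :=
  let lin : {poly K} := a1 E *: 'X + (a3 E)%:P in
  let cub : {poly K} :=
    'X^3 + a2 E *: 'X^2 + a4 E *: 'X + (a6 E)%:P in
  'X^2 + (FracField.tofrac lin)%:P * 'X - (FracField.tofrac cub)%:P.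

Lemma weierstrass_poly_tail (F : fieldType) (l c : F) :
  (size (l%:P * 'X - c%:P)%R < size ('X^2 : {poly F}))%N.
Proof.
rewrite size_polyXn (leq_ltn_trans (size_polyD _ _)) //.
rewrite size_polyN gtn_max !ltnS (leq_trans (size_polyC_leq1 _)) // andbT.
rewrite (leq_trans (size_polyMleq _ _)) //.
by rewrite size_polyX addn2 /= ltnS size_polyC_leq1.
Qed.

Lemma size_weierstrass_poly : size weierstrass_poly = 3.
Proof.
by rewrite /weierstrass_poly -addrA size_polyDl ?weierstrass_poly_tail //
  size_polyXn.
Qed.

Lemma monic_weierstrass_poly : weierstrass_poly \is monic.
Proof.
by rewrite monicE /weierstrass_poly -addrA lead_coefDl
  ?weierstrass_poly_tail // lead_coefXn.
Qed.

Lemma fractionP (R : idomainType) (r : {fraction R}) :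
  exists n d : R,
    d != 0 /\ r * FracField.tofrac d = FracField.tofrac n.
Proof.
elim/quotP: r => r _; exists (frac r).1, (frac r).2.
split; first exact: denom_ratioP.
unlock FracField.tofrac; rewrite -[LHS]FracField.pi_mul; apply/eqmodP.
rewrite /= FracField.equivfE /FracField.mulf.
rewrite !numden_Ratio ?(oner_eq0, mulf_neq0, denom_ratioP) // ?mulr1 ?mul1r //.
by rewrite mulrC.
Qed.

Lemma root_weierstrass_poly (r : {fraction {poly K}}) :
  ~~ root weierstrass_poly r.
Proof.
have [n [d [d0 rd]]] := fractionP r.
apply/negP => /rootP; rewrite /weierstrass_poly !hornerE.
set lin : {poly K} := _ *: 'X + _; set cub : {poly K} := _ + _%:P => rr.
have size_lin : (size lin <= 2)%N.
  rewrite (leq_trans (size_polyD _ _)) // geq_max.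
  by rewrite (leq_trans (size_scale_leq _ _)) ?size_polyX //
    (leq_trans (size_polyC_leq1 _)).
have size_cub : size cub = 4.
  rewrite /cub -!addrA size_polyDl size_polyXn // !ltnS.
  rewrite (leq_trans (size_polyD _ _)) // geq_max.
  rewrite (leq_trans (size_scale_leq _ _)) ?size_polyXn //=.
  rewrite (leq_trans (size_polyD _ _)) // geq_max.
  rewrite (leq_trans (size_scale_leq _ _)) ?size_polyX //=.
  exact: leq_trans (size_polyC_leq1 _) _.
move: lin cub rr size_lin size_cub => lin cub rr size_lin size_cub.
have E1 : n * n + lin * (n * d) = cub * (d * d).
  apply/eqP; rewrite -tofrac_eq !(rmorphM, rmorphD) /= -rd.
  set D := FracField.tofrac d; set L := FracField.tofrac lin.
  set C := FracField.tofrac cub.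
  have -> : C = r ^+ 2 + L * r.
    by apply/esym/eqP; rewrite -subr_eq0 rr.
  by apply/eqP; ring.
have cub0 : cub != 0 by rewrite -size_poly_eq0 size_cub.
have sizeR : size (cub * (d * d)) = (3 + (size d + size d).-1)%N.
  rewrite !size_mul ?mulf_neq0 // size_cub.
  by move: d0; rewrite -size_poly_gt0; case: (size d).
have n0 : n != 0.
  apply: contraNneq d0 => n0; move/eqP: E1.
  by rewrite n0 !(mul0r, mulr0) addr0 eq_sym !mulf_eq0 (negPf cub0) /= orbb.
have sd : (0 < size d)%N by rewrite size_poly_gt0.
have sn : (0 < size n)%N by rewrite size_poly_gt0.
have sizeN : size (n * n) = (size n + size n).-1 by rewrite size_mul.
have sizeM : (size (lin * (n * d))%R <= (size n + size d))%N.
  apply: leq_trans (size_polyMleq _ _) _.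
  rewrite (size_mul n0 d0); lia.
have [le_nd|lt_dn] := leqP (size n) (size d).+1.
  have: (size (n * n + lin * (n * d))%R <= 1 + (size d + size d))%N.
    apply: leq_trans (size_polyD _ _) _; rewrite geq_max sizeN.
    apply/andP; split; [|apply: leq_trans sizeM _];
      by move: sd sn le_nd; clear; lia.
  rewrite E1 sizeR; lia.
have : size (n * n + lin * (n * d)) = (size n + size n).-1.
  rewrite size_polyDl sizeN //; apply: leq_ltn_trans sizeM _.
  by move: sd sn lt_dn; clear; lia.
rewrite E1 sizeR; lia.
Qed.

Lemma weierstrass_poly_irreducible : monic_irreducible_poly weierstrass_poly.
Proof.
split; last exact: monic_weierstrass_poly.
apply: cubic_irreducible; first by rewrite size_weierstrass_poly.
exact: root_weierstrass_poly.
Qed.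

(* The function field K(E) = K(x)[y]/(Weierstrass equation). *)
Definition funfield : fieldType :=
  {poly %/ weierstrass_poly with weierstrass_poly_irreducible}.

(* The class of a polynomial in y with coefficients in K(x). *)
Definition fproj : {poly {fraction {poly K}}} -> funfield :=
  in_qpoly weierstrass_poly.

Fact fproj_is_zmod_morphism : zmod_morphism fproj.
Proof. exact: (raddfB (in_qpoly weierstrass_poly)). Qed.

Fact fproj_is_monoid_morphism : monoid_morphism fproj.
Proof. exact: (in_qpoly_monoid_morphism weierstrass_poly). Qed.

HB.instance Definition _ := GRing.isZmodMorphism.Build
  {poly {fraction {poly K}}} funfield fproj fproj_is_zmod_morphism.
HB.instance Definition _ := GRing.isMonoidMorphism.Build
  {poly {fraction {poly K}}} funfield fproj fproj_is_monoid_morphism.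

Lemma fproj_weierstrass_poly : fproj weierstrass_poly = 0 :> funfield.
Proof.
apply: val_inj => /=; rewrite mk_monicE; last first.
  exact: weierstrass_poly_irreducible.
exact: Pdiv.RingMonic.rmodpp monic_weierstrass_poly.
Qed.

(* Without this, unification and /= unfold the quotient construction. *)
#[global] Opaque funfield fproj.

(* Polynomial functions in x. *)
Definition fpoly : {poly K} -> funfield :=
  fproj \o polyC \o @FracField.tofrac {poly K}.

HB.instance Definition _ := GRing.RMorphism.on fpoly.

Definition fconst : K -> funfield := fpoly \o polyC.

HB.instance Definition _ := GRing.RMorphism.on fconst.

Definition fx : funfield := fpoly 'X.
Definition fy : funfield := fproj 'X.

(* The tautological K(E)-rational point (x, y) of E. *)
Definition generic_point : point funfield := Some (fx, fy).

Lemma quadratic_morph (F : fieldType) (S : comNzRingType)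
    (phi : {rmorphism {poly F} -> S}) (l c : F) :
  phi ('X^2 + l%:P * 'X - c%:P) = phi 'X ^+ 2 + phi l%:P * phi 'X - phi c%:P.
Proof. by rewrite rmorphB rmorphD rmorphXn rmorphM. Qed.

Lemma linear_morph (S : comNzRingType) (phi : {rmorphism {poly K} -> S}) a b :
  phi (a *: 'X + b%:P) = phi a%:P * phi 'X + phi b%:P.
Proof. by rewrite -mul_polyC rmorphD rmorphM. Qed.

Lemma cubic_morph (S : comNzRingType) (phi : {rmorphism {poly K} -> S}) a b c :
  phi ('X^3 + a *: 'X^2 + b *: 'X + c%:P)
    = phi 'X ^+ 3 + phi a%:P * phi 'X ^+ 2 + phi b%:P * phi 'X + phi c%:P.
Proof.
by rewrite -!mul_polyC !rmorphD [phi (_ * 'X^2)]rmorphM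
  [phi (_ * 'X)]rmorphM !rmorphXn.
Qed.

Lemma generic_point_on_curve : on_curve (map_curve fconst E) generic_point.
Proof.
have /eqP : fy ^+ 2 + fpoly (a1 E *: 'X + (a3 E)%:P) * fy
    - fpoly ('X^3 + a2 E *: 'X^2 + a4 E *: 'X + (a6 E)%:P) = 0.
  exact: etrans (esym (quadratic_morph _ _ _)) fproj_weierstrass_poly.
by rewrite linear_morph cubic_morph mulrDl addrA subr_eq0.
Qed.

End FunctionField.

Section RiemannRoch.
Variables (K : fieldType) (E : weierstrass K).

(* Evaluation at the projective coordinates of A of the homogeneous form
   sum_(i + j <= n) (c i j) X^i Y^j Z^(n - i - j). *)
Definition form_eval (L : fieldType) (phi : K -> L) (n : nat)
    (c : nat -> nat -> K) (A : point L) : L :=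
  let: (X, Y, Z) := proj_coords A in
  \sum_(i < n.+1) \sum_(j < n.+1 | (i + j <= n)%N)
    phi (c i j) * X ^+ i * Y ^+ j * Z ^+ (n - i - j).

(* For A in E(L), phi : K -> L a field extension: f is regular at A, with value
   v, if f = p/q on E for forms p, q over K of the same degree, q(A) <> 0. *)
Definition has_value (L : fieldType) (phi : K -> L) (A : point L)
    (f : funfield E) (v : L) : Prop :=
  exists n p q,
    [/\ form_eval phi n q A != 0,
        f * form_eval (@fconst K E) n q (generic_point E)
          = form_eval (@fconst K E) n p (generic_point E) &
        v = form_eval phi n p A / form_eval phi n q A].

Definition regular (L : fieldType) (phi : K -> L) (A : point L)
    (f : funfield E) : Prop :=
  exists v, has_value phi A f v.

(* A generator of the maximal ideal of the local ring at (the closed point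
   of E below) A. *)
Definition uniformizer (L : fieldType) (phi : K -> L) (A : point L)
    (pi : funfield E) : Prop :=
  has_value phi A pi 0 /\
  forall g, has_value phi A g 0 -> exists2 h, regular phi A h & g = pi * h.

(* ord_A(f) = m : f is pi^m times a unit of the local ring at A. *)
Definition ord_at (L : fieldType) (phi : K -> L) (A : point L)
    (f : funfield E) (m : int) : Prop :=
  exists pi w v,
    [/\ uniformizer phi A pi, has_value phi A w v, v != 0 & f = pi ^ m * w].

(* f = 0 or div(f) + D >= 0, where D is the sum of the K-rational points in a
   list. Orders are tested at the points of E over all extensions L of K, so
   that every closed point of E is taken into account. *)
Definition riemann_roch (D : seq (point K)) (f : funfield E) : Prop :=
  f = 0 \/
  forall (L : fieldType) (phi : {rmorphism K -> L}) (A : point L) (m : int),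
    on_curve (map_curve phi E) A -> ord_at phi A f m ->
    0 <= m + (count_mem A [seq map_point phi B | B <- D])%:Z.

End RiemannRoch.

Section Bases.
Variables (K : fieldType) (E : weierstrass K).

Definition const_point : point K -> point (funfield E) :=
  map_point (@fconst K E).

(* x_A and y_A: pulling x and y back along the translation tau_(-A) amounts to
   taking the coordinates of (x, y) - A, in the group E(K(E)). *)
Definition generic_sub (A : point K) : point (funfield E) :=
  psub (map_curve (@fconst K E) E) (generic_point E) (const_point A).
Definition x_ (A : point K) : funfield E := xcoord (generic_sub A).
Definition y_ (A : point K) : funfield E := ycoord (generic_sub A).

Definition u_ (A B : point K) : funfield E :=
  (y_ A - fconst E (ycoord (psub E A B)))
    / (x_ A - fconst E (xcoord (psub E A B))).

(* The effective divisor <t>, for t of order d. *)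
Definition cyclic_divisor (t : point K) (d : nat) : seq (point K) :=
  [seq pmul E l t | l <- iota 0 d].

(* This sum is in fact a constant; it is taken here as an element of K(E). *)
Definition u_sum (t : point K) (d : nat) : funfield E :=
  \sum_(l < d) u_ (pmul E l t) (pmul E l.+1 t).

Definition u_basis (t : point K) (d : nat) (l : 'I_d) : funfield E :=
  u_ (pmul E l t) (pmul E l.+1 t) + (1 - u_sum t d) / d%:R.

Definition v_basis (t : point K) (d : nat) (l : 'I_d) : funfield E :=
  if l == 0 :> nat then 1 else u_ None (pmul E l t).

End Bases.

Section StraightLinePrograms.
Variable K : Type.

(* Reg i refers to the i-th entry of the list formed by the inputs followed by
   the results of the operations performed so far. *)
Inductive operand := Reg of nat | Cst of K.

Inductive operation := Add of operand & operand | Scale of K & operand.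

Record slp := Slp { slp_body : seq operation; slp_outputs : seq operand }.

Definition slp_cost (P : slp) : nat := size (slp_body P).

Definition operand_ok (n : nat) (o : operand) : bool :=
  if o is Reg i then (i < n)%N else true.

Definition operation_ok (n : nat) (op : operation) : bool :=
  match op with
  | Add o1 o2 => operand_ok n o1 && operand_ok n o2
  | Scale _ o => operand_ok n o
  end.

Fixpoint body_ok (n : nat) (s : seq operation) : bool :=
  if s is op :: s' then operation_ok n op && body_ok n.+1 s' else true.

(* P has n inputs and m outputs, and only refers to available entries. *)
Definition slp_ok (n m : nat) (P : slp) : bool :=
  [&& body_ok n (slp_body P),
      all (operand_ok (n + slp_cost P)) (slp_outputs P) &
      size (slp_outputs P) == m].

End StraightLinePrograms.

Section Evaluation.
Variable K : fieldType.

Definition operand_val (regs : seq K) (o : operand K) : K :=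
  match o with Reg i => nth 0 regs i | Cst c => c end.

Definition operation_val (regs : seq K) (op : operation K) : K :=
  match op with
  | Add o1 o2 => operand_val regs o1 + operand_val regs o2
  | Scale c o => c * operand_val regs o
  end.

Definition slp_run (P : slp K) (input : seq K) : seq K :=
  let regs := foldl (fun r op => rcons r (operation_val r op))
                    input (slp_body P) in
  [seq operand_val regs o | o <- slp_outputs P].

End Evaluation.

(* Main.v *)
From HB Require Import structures.
Require Import Defs.
From mathcomp Require Import all_boot all_order all_algebra.
From mathcomp Require Import boolp reals exp.
From mathcomp Require Import fraction zify ring.

Set Implicit Arguments.
Unset Strict Implicit.
Unset Printing Implicit Defensive.

Import Order.TTheory GRing.Theory Num.Theory.
Local Open Scope ring_scope.

(** Write lam(P, Q) for the slope of the line through P and Q (after completing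
    the square).  As lam(P, Q) = zeta(P+Q) - zeta(P) - zeta(Q) analytically, it
    is a 2-cocycle, and lam(P, Q)^2 = x(P) + x(Q) + x(P+Q) + constant.  Both bases
    reduce, in O(d) operations, to the functions z |-> lam(z, -kt).  For T of
    order two put h(z) = lam(z, T) and
      lam'(P, Q) = 2 lam(P, Q) + h(P+Q) - h(P) - h(Q).
    Then lam' is T-invariant, h changes sign under translation by T, and
      h(P) h(Q) = h(P+Q) lam'(P, Q) + x(P+Q) - x(P+Q+T).
    Hence the T-even part of a combination of the lam(z, -kt) is a combination of
    half as many functions lam'(z, -kt), and its T-odd part is a multiple of h(z)
    plus such a combination divided by h(z): evaluating at the d points b + lt
    costs two problems of size d/2 and O(d) operations.  (This is the 2-isogeny with kernel <T>, but lam' inherits the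
    formal properties of lam, so that the quotient curve is never needed.)  The
    hypothesis db <> O keeps every slope finite and h(b + lt) nonzero.

    Associativity of the group law and the cocycle relation come from factoring
    fractional ideals of K[E]: with I_P the ideal of P, one has
    I_P I_Q = (m_PQ) I_(P+Q), where m_PQ is the line through P and Q divided by
    the vertical line through P+Q, and I_P is not principal for P <> O because no
    element of K[E] has a norm of degree 1. *)

(** * Coordinate ring *)

Section CoordinateRingModel.
Variables (K : fieldType) (E : weierstrass K).

Definition lin_poly : {poly K} := a1 E *: 'X + (a3 E)%:P.
Definition cub_poly : {poly K} :=
  'X^3 + a2 E *: 'X^2 + a4 E *: 'X + (a6 E)%:P.

(* L stands for K(E), g for the embedding of K[x] and Y for y; working with an
   abstract L keeps unification away from the construction of [funfield E]. *)
Record coord_model (L : fieldType) (g : {poly K} -> L) (Y : L) : Prop :=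
  CoordModel {
    model_curve : Y ^+ 2 + g lin_poly * Y = g cub_poly;
    model_free : forall p q, g p + g q * Y = 0 -> p = 0 /\ q = 0 }.

(** A relation [g p + g q * Y = 0] with q nonzero would make Y the image of an element of F, hence
    give a root in F of the quadratic equation of the curve. With q = 0, injectivity of [t] gives p
    = 0. *)
Lemma coord_model_of_rootless (F L : fieldType)
    (t : {rmorphism {poly K} -> F}) (phi : {rmorphism F -> L}) (Y : L) :
  injective t ->
  (forall r, r ^+ 2 + t lin_poly * r - t cub_poly != 0) ->
  Y ^+ 2 + phi (t lin_poly) * Y = phi (t cub_poly) ->
  coord_model (phi \o t) Y.
Proof.
move=> t_inj no_root eqY; split=> // p q /=.
have [-> | q0] := eqVneq q 0.
  rewrite !rmorph0 mul0r addr0 => /eqP.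
  by rewrite fmorph_eq0 -(rmorph0 t) (inj_eq t_inj) => /eqP.
move=> pq0; have tq0 : t q != 0 by rewrite -(rmorph0 t) (inj_eq t_inj).
have Yr : Y = phi (- t p / t q).
  apply: (mulfI (x := phi (t q))); first by rewrite fmorph_eq0.
  rewrite -rmorphM mulrCA divff // mulr1 rmorphN.
  by apply/eqP; rewrite -addr_eq0 addrC pq0.
move: (- t p / t q) Yr => r Yr; case/negP: (no_root r).
rewrite -(fmorph_eq0 phi) rmorphB rmorphD rmorphXn rmorphM -Yr.
by rewrite subr_eq0 eqY.
Qed.

End CoordinateRingModel.

Lemma funfield_model (K : fieldType) (E : weierstrass K) :
  coord_model E (@fpoly K E) (fy E).
Proof.
pose phi : {rmorphism {fraction {poly K}} -> funfield E} := @fproj K E \o polyC.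
apply: (@coord_model_of_rootless K E _ _ (@FracField.tofrac {poly K}) phi (fy E)).
- by move=> p q /eqP; rewrite tofrac_eq => /eqP.
- move=> r; have := root_weierstrass_poly E r.
  by rewrite /root /weierstrass_poly !hornerE.
- have /eqP : fy E ^+ 2 + fpoly E (lin_poly E) * fy E - fpoly E (cub_poly E) = 0.
    exact: etrans (esym (quadratic_morph _ _ _)) (fproj_weierstrass_poly E).
  by rewrite subr_eq0 => /eqP.
Qed.

Section Coordinates.
Variables (K : fieldType) (E : weierstrass K) (L : fieldType).
Variables (g : {rmorphism {poly K} -> L}) (Y : L).
Hypothesis model : coord_model E g Y.

Local Notation lin := (lin_poly E).
Local Notation cub := (cub_poly E).

Definition polyxy (p q : {poly K}) : L := g p + g q * Y.

Lemma polyxy_inj p q p' q' : polyxy p q = polyxy p' q' -> p = p' /\ q = q'.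
Proof.
move=> /eqP; rewrite /polyxy -subr_eq0 opprD addrACA -mulrBl -!rmorphB => /eqP.
by case/(model_free model) => /eqP; rewrite subr_eq0 => /eqP ->
  /eqP; rewrite subr_eq0 => /eqP ->.
Qed.

Lemma polyxyD p q p' q' : polyxy p q + polyxy p' q' = polyxy (p + p') (q + q').
Proof. by rewrite /polyxy !rmorphD mulrDl addrACA. Qed.

Lemma polyxyN p q : - polyxy p q = polyxy (- p) (- q).
Proof. by rewrite /polyxy !rmorphN mulNr opprD. Qed.

Lemma polyxyM p q p' q' :
  polyxy p q * polyxy p' q'
  = polyxy (p * p' + q * q' * cub) (p * q' + q * p' - q * q' * lin).
Proof.
move: (model_curve model); rewrite /polyxy; move: lin cub => l c eqY.
rewrite !(rmorphB, rmorphD, rmorphM) -eqY /=.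
move: (g p) (g q) (g p') (g q') (g l) => P Q P' Q' l'; ring.
Qed.

Lemma polyxyX p : polyxy p 0 = g p.
Proof. by rewrite /polyxy rmorph0 mul0r addr0. Qed.

Lemma polyxyY : polyxy 0 1 = Y.
Proof. by rewrite /polyxy rmorph0 rmorph1 mul1r add0r. Qed.

Definition polyfun (z : L) : Prop := exists p q, z = polyxy p q.

Lemma polyfun_g p : polyfun (g p).
Proof. by exists p, 0; rewrite polyxyX. Qed.

Lemma polyfun_y : polyfun Y.
Proof. by exists 0, 1; rewrite polyxyY. Qed.

Lemma polyfunD u v : polyfun u -> polyfun v -> polyfun (u + v).
Proof.
by case=> p [q ->] [p' [q' ->]]; exists (p + p'), (q + q'); rewrite polyxyD.
Qed.

Lemma polyfunN u : polyfun u -> polyfun (- u).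
Proof. by case=> p [q ->]; exists (- p), (- q); rewrite polyxyN. Qed.

Lemma polyfunB u v : polyfun u -> polyfun v -> polyfun (u - v).
Proof. by move=> hu hv; apply/polyfunD/polyfunN. Qed.

Lemma polyfunM u v : polyfun u -> polyfun v -> polyfun (u * v).
Proof. by case=> p [q ->] [p' [q' ->]]; rewrite polyxyM; do 2!eexists. Qed.

Lemma polyfun0 : polyfun 0.
Proof. by rewrite -(rmorph0 g); exact: polyfun_g. Qed.

Lemma polyfun1 : polyfun 1.
Proof. by rewrite -(rmorph1 g); exact: polyfun_g. Qed.

(** Product of p + q Y with its conjugate under Y -> - Y - [lin], that is, the norm down to K[x]. *)
Definition norm (p q : {poly K}) : {poly K} := p ^+ 2 - p * q * lin - q ^+ 2 * cub.

Lemma normM p q p' q' :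
  norm (p * p' + q * q' * cub) (p * q' + q * p' - q * q' * lin)
  = norm p q * norm p' q'.
Proof. by rewrite /norm; ring. Qed.

Lemma size_cub_poly : size cub = 4.
Proof.
rewrite /cub_poly -!addrA size_polyDl size_polyXn // !ltnS.
rewrite (leq_trans (size_polyD _ _)) // geq_max.
rewrite (leq_trans (size_scale_leq _ _)) ?size_polyXn //=.
rewrite (leq_trans (size_polyD _ _)) // geq_max.
rewrite (leq_trans (size_scale_leq _ _)) ?size_polyX //=.
exact: leq_trans (size_polyC_leq1 _) _.
Qed.

Lemma size_lin_poly : (size lin <= 2)%N.
Proof.
rewrite (leq_trans (size_polyD _ _)) // geq_max.
by rewrite (leq_trans (size_scale_leq _ _)) ?size_polyX //
    (leq_trans (size_polyC_leq1 _)).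
Qed.

(* [p ^+ 2] has even degree and [q ^+ 2 * cub] odd degree at least 3, and one
   of them dominates the cross term. *)
Lemma size_norm p q : q != 0 -> (3 < size (norm p q))%N.
Proof.
move=> q0; rewrite /norm.
have sq : (0 < size q)%N by rewrite size_poly_gt0.
have size_qc : size (q ^+ 2 * cub) = (size q).*2.+2.
  have cub0 : cub != 0 by rewrite -size_poly_eq0 size_cub_poly.
  rewrite size_mul ?expf_neq0 // size_cub_poly expr2 size_mul //.
  by move: sq; case: (size q) => // n _; rewrite addnS /=; lia.
have size_pq : (size (p * q * lin)%R <= size p + size q)%N.
  apply: leq_trans (size_polyMleq _ _) _; have := size_lin_poly.
  have := size_polyMleq p q; lia.
have [->|p0] := eqVneq p 0.
  by rewrite expr0n mul0r mul0r subr0 add0r size_polyN size_qc; lia.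
have sp : (0 < size p)%N by rewrite size_poly_gt0.
have size_pp : size (p ^+ 2) = (size p).*2.-1.
  by rewrite expr2 size_mul // addnn.
have [le_pq|lt_qp] := leqP (size p) (size q).+1.
  rewrite addrC size_polyDl size_polyN size_qc; first by lia.
  apply: leq_ltn_trans (size_polyD _ _) _; rewrite gtn_max size_polyN size_pp.
  apply/andP; split; first by lia.
  by apply: leq_ltn_trans size_pq _; lia.
rewrite -addrA size_polyDl size_pp; first by lia.
apply: leq_ltn_trans (size_polyD _ _) _; rewrite gtn_max !size_polyN size_qc.
apply/andP; split; last by lia.
by apply: leq_ltn_trans size_pq _; lia.
Qed.

(** The norms of u and v multiply to 1, so [size_norm] excludes any Y-component in u; what remains
    is a polynomial in x dividing 1. *)
Lemma polyfun_unit u v : polyfun u -> polyfun v -> u * v = 1 ->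
  exists2 k, k != 0 & u = g k%:P.
Proof.
case=> p [q ->] [p' [q' ->]]; rewrite polyxyM -(rmorph1 g) -polyxyX.
move=> /polyxy_inj [E1 E2]; have := normM p q p' q'.
rewrite E1 E2 {1}/norm mulr0 mul0r expr1n subr0 expr0n mul0r subr0 => /esym N1.
have : size (norm p q * norm p' q') = 1%N by rewrite N1 size_poly1.
have N0 : norm p q * norm p' q' != 0 by rewrite N1 oner_neq0.
rewrite size_mul; last 2 first.
- by apply: contraNneq N0 => ->; rewrite mul0r.
- by apply: contraNneq N0 => ->; rewrite mulr0.
have [q0|/(size_norm p)] := eqVneq q 0; last first.
  have : (0 < size (norm p' q'))%N.
    by rewrite size_poly_gt0; apply: contraNneq N0 => ->; rewrite mulr0.
  by case: (size (norm p q)) => [|[|[|n]]] //; case: size => // n'; rewrite addnS.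
move=> _; move: E1; rewrite q0 mul0r mul0r addr0 => pp1.
have : size p == 1%N.
  rewrite -dvdp1; apply/dvdpP; exists p'.
  by rewrite mulrC.
move/size_poly1P => [k k0 ->]; exists k => //; exact: polyxyX.
Qed.

(** A relation rather than a function, because z lives in the abstract field L; uniqueness of the
    expression p + q Y makes it single-valued. *)
Definition value_at (x y : K) (z : L) (v : K) : Prop :=
  exists p q, z = polyxy p q /\ v = p.[x] + q.[x] * y.

Lemma value_at_fun x y z v w : value_at x y z v -> value_at x y z w -> v = w.
Proof. by case=> p [q [-> ->]] [p' [q' [/polyxy_inj [-> ->] ->]]]. Qed.

Lemma value_at_poly x y p : value_at x y (g p) p.[x].
Proof. by exists p, 0; rewrite polyxyX horner0 mul0r addr0. Qed.

Lemma value_at_y x y : value_at x y Y y.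
Proof. by exists 0, 1; rewrite polyxyY horner0 hornerC mul1r add0r. Qed.

Lemma value_at_polyfun x y z : polyfun z -> exists v, value_at x y z v.
Proof. by case=> p [q ->]; eexists; exists p, q. Qed.

Lemma value_atD x y z z' v v' :
  value_at x y z v -> value_at x y z' v' -> value_at x y (z + z') (v + v').
Proof.
case=> p [q [-> ->]] [p' [q' [-> ->]]]; exists (p + p'), (q + q').
by rewrite polyxyD !hornerD mulrDl addrACA.
Qed.

Lemma value_atN x y z v : value_at x y z v -> value_at x y (- z) (- v).
Proof.
case=> p [q [-> ->]]; exists (- p), (- q).
by rewrite polyxyN !hornerN mulNr opprD.
Qed.

Lemma value_atM x y z z' v v' : on_curve E (Some (x, y)) ->
  value_at x y z v -> value_at x y z' v' -> value_at x y (z * z') (v * v').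
Proof.
move=> /eqP xyE [p [q [-> ->]]] [p' [q' [-> ->]]].
rewrite polyxyM; do 2!eexists; split; first reflexivity.
have -> : (p * p' + q * q' * cub).[x]
    = p.[x] * p'.[x] + q.[x] * q'.[x] * cub.[x] by rewrite !hornerE.
have -> : cub.[x] = y ^+ 2 + a1 E * x * y + a3 E * y.
  by rewrite xyE /cub_poly !hornerE.
have -> : (p * q' + q * p' - q * q' * lin).[x] = p.[x] * q'.[x]
   + q.[x] * p'.[x] - q.[x] * q'.[x] * (a1 E * x + a3 E).
  by rewrite /lin_poly !hornerE.
ring.
Qed.

End Coordinates.

(** * Chords and tangents *)

Section PointAlgebra.
Variables (K : fieldType) (E : weierstrass K).

(** If both partial derivatives vanished at (x, y), they and the equation of the curve would
    determine a3, a4 and a6; with these values the discriminant is identically zero. *)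
Lemma nonsingular (x y : K) : discriminant E != 0 -> on_curve E (Some (x, y)) ->
  2 * y + a1 E * x + a3 E = 0 ->
  3 * x ^+ 2 + 2 * a2 E * x + a4 E - a1 E * y != 0.
Proof.
move=> /eqP disc0 /eqP xyE y2; apply/eqP => x3; apply: disc0.
have e3 : a3 E = - 2 * y - a1 E * x.
  by apply/eqP; rewrite -subr_eq0 -[0]y2; apply/eqP; ring.
have e4 : a4 E = a1 E * y - 3 * x ^+ 2 - 2 * a2 E * x.
  by apply/eqP; rewrite -subr_eq0 -[0]x3; apply/eqP; ring.
have e6 : a6 E = y ^+ 2 + a1 E * x * y + a3 E * y - x ^+ 3 - a2 E * x ^+ 2
    - a4 E * x.
  by rewrite xyE; ring.
by rewrite /discriminant e6 e4 e3; ring.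
Qed.

Definition slope (P Q : point K) : K :=
  match P, Q with
  | Some (x1, y1), Some (x2, y2) =>
    if x1 == x2
    then (3 * x1 ^+ 2 + 2 * a2 E * x1 + a4 E - a1 E * y1)
         / (2 * y1 + a1 E * x1 + a3 E)
    else (y2 - y1) / (x2 - x1)
  | _, _ => 0
  end.

(* The line y = l x + m meets the curve in points of abscissas x1, x2, x3. *)
Definition line_meets (l m x1 x2 x3 : K) : Prop :=
  [/\ x1 + x2 + x3 = l ^+ 2 + a1 E * l - a2 E,
      x1 * x2 + x1 * x3 + x2 * x3 = a4 E - 2 * l * m - a1 E * m - a3 E * l &
      x1 * x2 * x3 = m ^+ 2 + a3 E * m - a6 E].

Lemma line_meetsC12 l m x1 x2 x3 :
  line_meets l m x1 x2 x3 -> line_meets l m x2 x1 x3.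
Proof. by case=> e1 e2 e3; split; rewrite -?e1 -?e2 -?e3; ring. Qed.

Lemma line_meetsC13 l m x1 x2 x3 :
  line_meets l m x1 x2 x3 -> line_meets l m x3 x2 x1.
Proof. by case=> e1 e2 e3; split; rewrite -?e1 -?e2 -?e3; ring. Qed.

Lemma line_meets_on_curve l m x1 x2 x3 :
  line_meets l m x1 x2 x3 -> on_curve E (Some (x1, l * x1 + m)).
Proof.
case=> e1 e2 e3; apply/eqP.
have -> : a6 E = m ^+ 2 + a3 E * m - x1 * x2 * x3 by rewrite e3; ring.
have -> : a4 E = x1 * x2 + x1 * x3 + x2 * x3 + 2 * l * m + a1 E * m + a3 E * l.
  by rewrite e2; ring.
have -> : a2 E = l ^+ 2 + a1 E * l - (x1 + x2 + x3) by rewrite e1; ring.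
ring.
Qed.

(** At a double intersection the derivative of the equation along the line vanishes, so a vanishing
    y-derivative would force a vanishing x-derivative, against [nonsingular]. *)
Lemma line_meets_double l m x0 x3 : discriminant E != 0 ->
  line_meets l m x0 x0 x3 -> 2 * (l * x0 + m) + a1 E * x0 + a3 E != 0.
Proof.
move=> disc0 lm; apply/eqP => y2.
case/eqP: (nonsingular disc0 (line_meets_on_curve lm) y2).
case: lm => e1 e2 _.
have -> : a4 E = x0 * x0 + x0 * x3 + x0 * x3 + 2 * l * m + a1 E * m + a3 E * l.
  by rewrite e2; ring.
have -> : a2 E = l ^+ 2 + a1 E * l - (x0 + x0 + x3) by rewrite e1; ring.
by rewrite -[RHS](mulr0 l) -[in RHS]y2; ring.
Qed.

Lemma poppK : involutive (popp E).
Proof. by case=> [[x y]|] //=; congr (Some (_, _)); ring. Qed.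

Lemma on_curve_popp P : on_curve E (popp E P) = on_curve E P.
Proof.
by case: P => [[x y]|] //=; congr (_ == _); ring.
Qed.

Lemma eq_x_on_curve x y y' :
  on_curve E (Some (x, y)) -> on_curve E (Some (x, y')) ->
  Some (x, y') != popp E (Some (x, y)) -> y' = y.
Proof.
move=> /eqP e /eqP e' ny.
have : (y' - y) * (y' - (- y - a1 E * x - a3 E)) = 0.
  by rewrite -(subrr (y ^+ 2 + a1 E * x * y + a3 E * y)) {1}e -e'; ring.
move/eqP; rewrite mulf_eq0 !subr_eq0 => /orP [/eqP //|/eqP y'E].
by case/eqP: ny; rewrite y'E.
Qed.

Lemma y_neq_popp x y : Some (x, y) != popp E (Some (x, y)) ->
  2 * y + a1 E * x + a3 E != 0.
Proof.
apply: contraNneq => y2; apply/eqP; congr (Some (_, _)).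
by apply/eqP; rewrite -subr_eq0 -[0]y2; apply/eqP; ring.
Qed.

(** The third abscissa is chosen to satisfy the first of the three Vieta relations. The second comes
    from the slope, and the third from the equation of the curve at the first point. *)
Lemma slope_line x1 y1 x2 y2 (l := slope (Some (x1, y1)) (Some (x2, y2))) :
  on_curve E (Some (x1, y1)) -> on_curve E (Some (x2, y2)) ->
  Some (x2, y2) != popp E (Some (x1, y1)) ->
  line_meets l (y1 - l * x1) x1 x2 (l ^+ 2 + a1 E * l - a2 E - x1 - x2)
  /\ y2 = l * x2 + (y1 - l * x1).
Proof.
move=> c1 c2 npp; set m := y1 - l * x1; set x3 := _ - x1 - x2.
have y1E : y1 = l * x1 + m by rewrite /m; ring.
have y2E : y2 = l * x2 + m.
  rewrite /m /l /slope; have [x12|x12] := eqVneq x1 x2.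
    by move: c2 npp; rewrite -x12 => c2 npp; rewrite (eq_x_on_curve c1 c2 npp); ring.
  by field; rewrite subr_eq0 eq_sym.
split=> //.
have e1 : x1 + x2 + x3 = l ^+ 2 + a1 E * l - a2 E by rewrite /x3; ring.
have e2 : x1 * x2 + x1 * x3 + x2 * x3 = a4 E - 2 * l * m - a1 E * m - a3 E * l.
  have [x12|x12] := eqVneq x1 x2.
    have y12 : y2 = y1.
      by move: c2 npp; rewrite -x12 => c2 npp; rewrite (eq_x_on_curve c1 c2 npp).
    have y0 : 2 * y1 + a1 E * x1 + a3 E != 0.
      by apply: y_neq_popp; move: npp; rewrite -x12 y12.
    have lE : l * (2 * y1 + a1 E * x1 + a3 E)
        = 3 * x1 ^+ 2 + 2 * a2 E * x1 + a4 E - a1 E * y1.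
      by rewrite /l /slope x12 eqxx -x12 divfK.
    have -> : a4 E = l * (2 * y1 + a1 E * x1 + a3 E) - 3 * x1 ^+ 2
       - 2 * a2 E * x1 + a1 E * y1 by rewrite lE; ring.
    by rewrite /x3 -x12 y1E; ring.
  (* Chord case: subtract the equations of the curve at the two points and cancel [x1 - x2]. *)
  apply/eqP; rewrite -subr_eq0; apply/eqP.
  have x120 : x1 - x2 != 0 by rewrite subr_eq0.
  apply: (mulfI x120); rewrite mulr0.
  move: c1 c2 => /eqP + /eqP; rewrite y1E y2E => c1 c2.
  rewrite -(subrr (x1 ^+ 3 + a2 E * x1 ^+ 2 + a4 E * x1 + a6 E
     - (x2 ^+ 3 + a2 E * x2 ^+ 2 + a4 E * x2 + a6 E))) -{1}c1 -{1}c2 /x3.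
  ring.
split=> //.
move/eqP: c1; rewrite y1E => c1.
have -> : a6 E = (l * x1 + m) ^+ 2 + a1 E * x1 * (l * x1 + m)
   + a3 E * (l * x1 + m) - (x1 ^+ 3 + a2 E * x1 ^+ 2 + a4 E * x1).
  by rewrite c1; ring.
have -> : a4 E = x1 * x2 + x1 * x3 + x2 * x3 + 2 * l * m + a1 E * m + a3 E * l.
  by rewrite e2; ring.
by rewrite /x3; ring.
Qed.

Lemma padd_slope x1 y1 x2 y2 (l := slope (Some (x1, y1)) (Some (x2, y2)))
    (m := y1 - l * x1) (x3 := l ^+ 2 + a1 E * l - a2 E - x1 - x2) :
  Some (x2, y2) != popp E (Some (x1, y1)) ->
  padd E (Some (x1, y1)) (Some (x2, y2)) = popp E (Some (x3, l * x3 + m)).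
Proof.
move=> npp; rewrite /padd (negPf npp) -/x3 /m /popp; congr (Some (_, _)).
by rewrite -/(slope (Some (x1, y1)) (Some (x2, y2))) -/l -/x3; ring.
Qed.

Lemma on_curve_padd P Q : on_curve E P -> on_curve E Q -> on_curve E (padd E P Q).
Proof.
case: P => [[x1 y1]|] //; case: Q => [[x2 y2]|] // c1 c2.
have [->|npp] := eqVneq (Some (x2, y2)) (popp E (Some (x1, y1))).
  by rewrite /padd eqxx.
rewrite padd_slope // on_curve_popp.
have [lm _] := slope_line c1 c2 npp.
exact: line_meets_on_curve (line_meetsC13 lm).
Qed.

End PointAlgebra.

(** * Fractional ideals of the coordinate ring and the group law *)

Section Ideals.
Variables (K : fieldType) (E : weierstrass K) (L : fieldType).
Variables (g : {rmorphism {poly K} -> L}) (Y : L).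
Hypothesis model : coord_model E g Y.

Local Notation polyfun := (polyfun g Y).
Local Notation X := (g 'X).
Local Notation c k := (g k%:P).

Definition submodule (I : L -> Prop) : Prop :=
  [/\ I 0, forall u v, I u -> I v -> I (u + v) &
      forall a u, polyfun a -> I u -> I (a * u)].

(** Finite sums of products. Scalars from the coordinate ring are left out since a submodule J
    absorbs them. *)
Inductive imul (I J : L -> Prop) : L -> Prop :=
| imul0 : imul I J 0
| imul_add u v w of I u & J v & imul I J w : imul I J (u * v + w).

Definition prin (u z : L) : Prop := exists2 a, polyfun a & z = a * u.

Definition gen2 (u v z : L) : Prop :=
  exists a b, [/\ polyfun a, polyfun b & z = a * u + b * v].

Lemma mem_imul (I J : L -> Prop) u v : I u -> J v -> imul I J (u * v).
Proof. by move=> Iu Jv; rewrite -[u * v]addr0; apply: imul_add => //; apply: imul0. Qed.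

Lemma imulD I J u v : imul I J u -> imul I J v -> imul I J (u + v).
Proof.
by move=> h hv; elim: h => [|a b w Ia Jb _ IH]; rewrite ?add0r // -addrA; exact: imul_add.
Qed.

Lemma imul_le (I J M : L -> Prop) :
  M 0 -> (forall u v, M u -> M v -> M (u + v)) ->
  (forall u v, I u -> J v -> M (u * v)) -> forall z, imul I J z -> M z.
Proof. by move=> M0 MD IJM z; elim=> // u v w Iu Jv _; apply: MD; exact: IJM. Qed.

Lemma submodule_imul I J : submodule J -> submodule (imul I J).
Proof.
case=> J0 JD JM; split; [exact: imul0|exact: imulD|].
move=> a u ia; elim=> [|v w r Iv Jw _ IH]; first by rewrite mulr0; exact: imul0.
by rewrite mulrDr mulrCA; apply: imul_add => //; exact: JM.
Qed.

(** Ideals are identified through extensionality of predicates, so that identities between them can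
    be used for rewriting. *)
Lemma imulC I J : imul I J = imul J I.
Proof.
by rewrite predeqE => z; split; apply: imul_le;
  [exact: imul0|exact: imulD|move=> u v ? ?; rewrite mulrC; exact: mem_imul
  |exact: imul0|exact: imulD|move=> u v ? ?; rewrite mulrC; exact: mem_imul].
Qed.

Lemma imulA_le I J M z : imul I (imul J M) z -> imul (imul I J) M z.
Proof.
apply: imul_le; [exact: imul0|exact: imulD|move=> u w Iu].
elim=> [|a b r Ja Mb _ IH]; first by rewrite mulr0; exact: imul0.
by rewrite mulrDr mulrA; apply: imulD => //; do 2!apply: mem_imul => //.
Qed.

Lemma imulA I J M : imul I (imul J M) = imul (imul I J) M.
Proof.
rewrite predeqE => z; split; first exact: imulA_le.
rewrite imulC (imulC I J) => /imulA_le.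
by rewrite (imulC (imul M J)) (imulC M J).
Qed.

Lemma submodule_prin u : submodule (prin u).
Proof.
split; first by (exists 0; rewrite ?mul0r //; exact: polyfun0).
- by move=> _ _ [a ia ->] [b ib ->]; exists (a + b); rewrite ?mulrDl //; exact: polyfunD.
- by move=> a _ ia [b ib ->]; exists (a * b); rewrite ?mulrA //; exact: (polyfunM model).
Qed.

Lemma submodule_gen2 u v : submodule (gen2 u v).
Proof.
split; first by (exists 0, 0; rewrite !mul0r addr0; split=> //; exact: polyfun0).
- move=> _ _ [a [b [ia ib ->]]] [a' [b' [ia' ib' ->]]].
  by exists (a + a'), (b + b'); split; [exact: polyfunD|exact: polyfunD|ring].
- move=> r _ hr [a [b [ia ib ->]]]; exists (r * a), (r * b).
  by split; [exact: (polyfunM model)|exact: (polyfunM model)|ring].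
Qed.

Lemma mem_prin u : prin u u.
Proof. by exists 1; rewrite ?mul1r //; exact: polyfun1. Qed.

Lemma mem_gen2l u v : gen2 u v u.
Proof.
exists 1, 0; rewrite mul1r mul0r addr0; split=> //; [exact: polyfun1|exact: polyfun0].
Qed.

Lemma mem_gen2r u v : gen2 u v v.
Proof.
exists 0, 1; rewrite mul1r mul0r add0r; split=> //; [exact: polyfun0|exact: polyfun1].
Qed.

Lemma prin_le u I z : submodule I -> I u -> prin u z -> I z.
Proof. by case=> _ _ IM Iu [a ia ->]; exact: IM. Qed.

Lemma imul_prinE u I z : submodule I ->
  imul (prin u) I z <-> exists2 w, I w & z = u * w.
Proof.
move=> mI; have [I0 ID IM] := mI; split; last first.
  by case=> w Iw ->; apply: mem_imul => //; exact: mem_prin.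
elim=> [|v w r [a ia ->] Iw _ [s Is ->]]; first by exists 0; rewrite ?mulr0.
by exists (a * w + s); [apply: ID => //; exact: IM|ring].
Qed.

Lemma imul_prin u v : imul (prin u) (prin v) = prin (u * v).
Proof.
rewrite predeqE => z; rewrite (imul_prinE _ _ (submodule_prin v)); split.
  by case=> _ [a ia ->] ->; exists a => //; ring.
by case=> a ia ->; exists (a * v); [exists a|ring].
Qed.

Lemma imul1 I : submodule I -> imul (prin 1) I = I.
Proof.
move=> mI; rewrite predeqE => z; rewrite imul_prinE //; split.
  by case=> w Iw ->; rewrite mul1r.
by exists z; rewrite ?mul1r.
Qed.

(** The generators differ by a unit of the coordinate ring, and [polyfun_unit] says that such units
    are constants. *)
Lemma prin_eq u v : v != 0 -> prin u = prin v ->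
  exists2 k, k != 0 & u = c k * v.
Proof.
move=> v0 uv; have := mem_prin u; rewrite uv => -[a ia ua].
have := mem_prin v; rewrite -uv => -[b ib vb].
have ba : a * b = 1.
  by apply: (mulIf v0); rewrite mul1r [RHS]vb ua; ring.
by have [k k0 ak] := polyfun_unit model ia ib ba; exists k => //; rewrite ua ak.
Qed.

Lemma submodule_const k (I : L -> Prop) z :
  k != 0 -> submodule I -> I (c k * z) -> I z.
Proof.
move=> k0 [_ _ IM] Ikz; have -> : z = c k^-1 * (c k * z).
  by rewrite mulrA -rmorphM -polyCM mulVf // rmorph1 mul1r.
by apply: IM => //; exact: polyfun_g.
Qed.

Lemma gen2_subr u v a : polyfun a -> gen2 u (v - a * u) = gen2 u v.
Proof.
move=> ia; rewrite predeqE => z; split=> -[r [s [hr hs ->]]].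
  exists (r - s * a), s; split=> //; last by ring.
  by apply: polyfunB => //; exact: (polyfunM model).
exists (r + s * a), s; split=> //; last by ring.
by apply: polyfunD => //; exact: (polyfunM model).
Qed.

(** The point O lies outside the affine curve, so the unit ideal stands for it; it is the neutral
    class. *)
Definition pideal (P : point K) : L -> Prop :=
  if P is Some (x, y) then gen2 (X - c x) (Y - c y) else prin 1.

Lemma submodule_pideal P : submodule (pideal P).
Proof. by case: P => [[x y]|]; [exact: submodule_gen2|exact: submodule_prin]. Qed.

Lemma curve_coords : Y ^+ 2 + (c (a1 E) * X + c (a3 E)) * Y
  = X ^+ 3 + c (a2 E) * X ^+ 2 + c (a4 E) * X + c (a6 E).
Proof.
have := model_curve model; rewrite /lin_poly /cub_poly -!mul_polyC.
by rewrite !(rmorphD, rmorphM, rmorphXn).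
Qed.

(** The equation of the curve minus its value at (x, y): both sides vanish on the vertical line
    through (x, y) and its opposite. *)
Lemma opp_factor x y : on_curve E (Some (x, y)) ->
  (Y - c y) * (Y - c (- y - a1 E * x - a3 E))
  = (X - c x) * (X ^+ 2 + X * c x + c x ^+ 2 + c (a2 E) * (X + c x) + c (a4 E)
                 - c (a1 E) * Y).
Proof.
move=> /eqP xyE.
have a6E : a6 E = y ^+ 2 + a1 E * x * y + a3 E * y - x ^+ 3 - a2 E * x ^+ 2 - a4 E * x.
  by rewrite xyE; ring.
move: curve_coords; rewrite a6E !(polyCB, polyCD, polyCM, polyC_exp, polyCN).
rewrite !(rmorphB, rmorphD, rmorphM, rmorphXn, rmorphN) /=.
move: (g 'X) (c x) (c y) (c (a1 E)) (c (a2 E)) (c (a3 E)) (c (a4 E)) => U u v b1 b2 b3 b4 e.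
transitivity (Y ^+ 2 + (b1 * U + b3) * Y + (b1 * u + b3) * Y - (b1 * U + b3) * Y
   - v * (v + b1 * u + b3)); first by ring.
by rewrite e; ring.
Qed.

Lemma pideal_opp x y : discriminant E != 0 -> on_curve E (Some (x, y)) ->
  imul (pideal (Some (x, y))) (pideal (popp E (Some (x, y)))) = prin (X - c x).
Proof.
move=> disc0 xyE; have fact := opp_factor xyE; rewrite predeqE => z; split.
  apply: imul_le => [||u v]; try by case: (submodule_prin (X - c x)).
  case=> r [s [hr hs ->]] [r' [s' [hr' hs' ->]]].
  set Q := (_ - c (a1 E) * Y) in fact.
  have iQ : polyfun Q.
    rewrite /Q -!(rmorphXn, rmorphM, rmorphD); apply: polyfunB.
      exact: polyfun_g.
    by apply: (polyfunM model); [exact: polyfun_g|exact: polyfun_y].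
  have iX k : polyfun (X - c k) by rewrite -rmorphB; exact: polyfun_g.
  have iY k : polyfun (Y - c k).
    by apply: polyfunB; [exact: polyfun_y|exact: polyfun_g].
  exists (r * r' * (X - c x) + r * s' * (Y - c (- y - a1 E * x - a3 E))
          + s * r' * (Y - c y) + s * s' * Q).
    by do ?apply: polyfunD; do ?apply: (polyfunM model).
  transitivity ((r * r' * (X - c x) + r * s' * (Y - c (- y - a1 E * x - a3 E))
    + s * r' * (Y - c y)) * (X - c x)
    + s * s' * ((Y - c y) * (Y - c (- y - a1 E * x - a3 E)))); first by ring.
  by rewrite fact; ring.
have mJ := submodule_imul (pideal (Some (x, y)))
  (submodule_pideal (popp E (Some (x, y)))).
apply: prin_le => //; have [J0 JD JM] := mJ.
set J := imul _ _ in mJ J0 JD JM *.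
have JXX : J ((X - c x) * (X - c x)).
  by apply: mem_imul; exact: mem_gen2l.
have JXY : J ((Y - c y) * (X - c x)).
  by apply: mem_imul; [exact: mem_gen2r|exact: mem_gen2l].
have JXY' : J ((X - c x) * (Y - c (- y - a1 E * x - a3 E))).
  by apply: mem_imul; [exact: mem_gen2l|exact: mem_gen2r].
have JYY : J ((Y - c y) * (Y - c (- y - a1 E * x - a3 E))).
  by apply: mem_imul; exact: mem_gen2r.
(* If the y-derivative is nonzero, the difference of the two mixed products of generators is a
   nonzero constant times X - x. Otherwise the x-derivative is nonzero by [nonsingular], and
   [opp_factor] produces it as the constant. *)
have [y2|y2] := eqVneq (2 * y + a1 E * x + a3 E) 0; last first.
  apply: (@submodule_const _ J _ y2 mJ).
  have -> : c (2 * y + a1 E * x + a3 E) * (X - c x) =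
     (X - c x) * (Y - c (- y - a1 E * x - a3 E)) + (- 1) * ((Y - c y) * (X - c x)).
    rewrite !(polyCB, polyCD, polyCM, polyCN).
    by rewrite !(rmorphB, rmorphD, rmorphM, rmorphN, rmorph_nat) /=; ring.
  apply: JD => //; apply: JM => //; apply: polyfunN; exact: polyfun1.
have x3 := nonsingular disc0 xyE y2.
apply: (@submodule_const _ J _ x3 mJ); move: JYY; rewrite fact => JYY.
have -> : c (3 * x ^+ 2 + 2 * a2 E * x + a4 E - a1 E * y) * (X - c x)
  = (X - c x) * (X ^+ 2 + X * c x + c x ^+ 2 + c (a2 E) * (X + c x) + c (a4 E)
                 - c (a1 E) * Y)
    + (g (- ('X + (2 * x + a2 E)%:P)) * ((X - c x) * (X - c x))
       + c (a1 E) * ((Y - c y) * (X - c x))).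
  rewrite !(polyCB, polyCD, polyCM, polyC_exp).
  by rewrite !(rmorphB, rmorphD, rmorphM, rmorphXn, rmorphN, rmorph_nat) /=; ring.
apply: (JD _ _ JYY); apply: JD; apply: JM => //; exact: polyfun_g.
Qed.

End Ideals.

(** * Ideals of three collinear points *)

Section LineIdeal.
Variables (K : fieldType) (E : weierstrass K) (L : fieldType).
Variables (g : {rmorphism {poly K} -> L}) (Y : L).
Hypothesis model : coord_model E g Y.
Hypothesis disc0 : discriminant E != 0.

Local Notation polyfun := (polyfun g Y).
Local Notation X := (g 'X).
Local Notation c k := (g k%:P).
Local Notation prin := (prin g Y).
Local Notation pideal := (pideal g Y).

Definition line (l m : K) : L := Y - c l * X - c m.

Definition conj_line (l m : K) : L :=
  - Y - c (a1 E) * X - c (a3 E) - c l * X - c m.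

(** The product of the line with its conjugate is, up to sign, the cubic obtained by substituting y
    = l x + m in the equation; its roots are the three abscissas. *)
Lemma line_norm l m x1 x2 x3 : line_meets E l m x1 x2 x3 ->
  line l m * conj_line l m = - ((X - c x1) * (X - c x2) * (X - c x3)).
Proof.
case=> e1 e2 e3; move: (curve_coords model); rewrite /line /conj_line.
have -> : a6 E = m ^+ 2 + a3 E * m - x1 * x2 * x3 by rewrite e3; ring.
have -> : a4 E = x1 * x2 + x1 * x3 + x2 * x3 + 2 * l * m + a1 E * m + a3 E * l.
  by rewrite e2; ring.
have -> : a2 E = l ^+ 2 + a1 E * l - (x1 + x2 + x3) by rewrite e1; ring.
rewrite !(polyCB, polyCD, polyCM, polyC_exp).
rewrite !(rmorphB, rmorphD, rmorphM, rmorphXn, rmorph_nat) /=.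
move: (g 'X) (c x1) (c x2) (c x3) (c (a1 E)) (c (a3 E)) (c l) (c m).
move=> U u1 u2 u3 b1 b3 l' m' e.
transitivity (- (Y ^+ 2 + (b1 * U + b3) * Y)
  + (l' * U + m') * (l' * U + m' + b1 * U + b3)); first by ring.
by rewrite e; ring.
Qed.

Lemma polyfun_line l m : polyfun (line l m).
Proof.
rewrite /line -!rmorphM.
by do ?apply: polyfunB; [exact: polyfun_y|exact: polyfun_g|exact: polyfun_g].
Qed.

Lemma polyfun_conj_line l m : polyfun (conj_line l m).
Proof.
rewrite /conj_line -!rmorphM; do ?apply: polyfunB; try exact: polyfun_g.
by apply: polyfunN; exact: polyfun_y.
Qed.

Lemma pideal_line l m x :
  pideal (Some (x, l * x + m)) = gen2 g Y (X - c x) (line l m).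
Proof.
rewrite /= -[LHS](gen2_subr model _ _ (polyfun_g g Y l%:P)).
congr (gen2 _ _ _ _).
by rewrite /line polyCD polyCM rmorphD rmorphM; ring.
Qed.

(* By nonsingularity, the conjugate line avoids every double intersection point. *)
Lemma unit_of_double l m x0 x3 (B : L -> Prop) : submodule g Y B ->
  line_meets E l m x0 x0 x3 ->
  B (conj_line l m) -> B (line l m ^+ 2) -> B (line l m * (X - c x0)) ->
  B ((X - c x0) ^+ 2) -> B 1.
Proof.
move=> mB lm B1 B2 B3 B4; have [_ BD BM] := mB.
have nz := line_meets_double disc0 lm.
set n := _ + a3 E in nz.
apply: (@submodule_const _ _ _ _ (n ^+ 2) B _ _ mB); first by rewrite expf_neq0.
set k := 2 * l + a1 E.
have sumE : line l m + conj_line l m = - (c n + c k * (X - c x0)).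
  rewrite /line /conj_line /n /k !(polyCB, polyCD, polyCM).
  by rewrite !(rmorphB, rmorphD, rmorphM, rmorph_nat) /=; ring.
have -> : c (n ^+ 2) * 1 = (conj_line l m + 2 * line l m
     + 2 * c k * (X - c x0)) * conj_line l m
   + (line l m ^+ 2 + (2 * c k * (line l m * (X - c x0))
     + c k ^+ 2 * (X - c x0) ^+ 2)).
  have -> : c (n ^+ 2) = (- (line l m + conj_line l m) - c k * (X - c x0)) ^+ 2.
    by rewrite sumE polyC_exp rmorphXn; ring.
  by move: (line l m) (conj_line l m) => u v; ring.
have p2 : polyfun 2 by rewrite -(rmorph_nat g); exact: polyfun_g.
have pX : polyfun (X - c x0) by rewrite -rmorphB; exact: polyfun_g.
have pk : polyfun (c k) by exact: polyfun_g.
have p2k : polyfun (2 * c k) by apply: (polyfunM model).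
have pl := polyfun_line l m; have pl' := polyfun_conj_line l m.
apply: (BD).
  apply: (BM) => //; apply: polyfunD; last by apply: (polyfunM model).
  by apply: polyfunD => //; apply: (polyfunM model).
apply: (BD) => //; apply: (BD); apply: (BM) => //.
by rewrite -rmorphXn; exact: polyfun_g.
Qed.

Lemma pideal_collinear l m x1 x2 x3 : line_meets E l m x1 x2 x3 ->
  imul (imul (pideal (Some (x1, l * x1 + m))) (pideal (Some (x2, l * x2 + m))))
       (pideal (Some (x3, l * x3 + m))) = prin (line l m).
Proof.
move=> lm; rewrite !pideal_line predeqE => z.
have nrm := line_norm lm.
have pl := polyfun_line l m; have pl' := polyfun_conj_line l m.
have pX k : polyfun (X - c k) by rewrite -rmorphB; exact: polyfun_g.
set D1 := X - c x1 in nrm *; set D2 := X - c x2 in nrm *.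
set D3 := X - c x3 in nrm *.
have [pD1 pD2 pD3] : [/\ polyfun D1, polyfun D2 & polyfun D3] by split; exact: pX.
split.
  move: z; apply: imul_le => [||u v]; try by case: (submodule_prin model (line l m)).
  move=> + [r3 [s3 [hr3 hs3 ->]]].
  move: u; apply: imul_le.
  - by rewrite mul0r; case: (submodule_prin model (line l m)).
  - move=> u w; rewrite mulrDl.
    by case: (submodule_prin model (line l m)) => _ + _; apply.
  move=> _ _ [r1 [s1 [hr1 hs1 ->]]] [r2 [s2 [hr2 hs2 ->]]].
  exists (s1 * (r2 * D2 + s2 * line l m) * (r3 * D3 + s3 * line l m)
     + r1 * D1 * s2 * (r3 * D3 + s3 * line l m)
     + r1 * D1 * (r2 * D2) * s3 - r1 * r2 * r3 * conj_line l m).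
    clear pX; clearbody D1 D2 D3.
    by apply: polyfunB; do ?[assumption | apply: polyfunD | apply: (polyfunM model)].
  transitivity ((s1 * (r2 * D2 + s2 * line l m) * (r3 * D3 + s3 * line l m)
     + r1 * D1 * s2 * (r3 * D3 + s3 * line l m)
     + r1 * D1 * (r2 * D2) * s3) * line l m + r1 * r2 * r3 * (D1 * D2 * D3)).
    by ring.
  by rewrite -[D1 * D2 * D3]opprK -nrm; ring.
set J := imul _ _.
have mJ : submodule g Y J by apply: submodule_imul; exact: (submodule_gen2 model).
apply: (prin_le mJ); have [J0 JD JM] := mJ.
(* The multipliers that send the line into J form a submodule, and it suffices to show that it
   contains 1. It contains the pairwise products of the verticals, the products of the line with the
   line and the verticals, and, by [line_norm], the conjugate line. *)
pose B w := J (w * line l m).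
have mB : submodule g Y B.
  split; rewrite /B; first by rewrite mul0r.
    by move=> u v Bu Bv; rewrite mulrDl; exact: JD.
  by move=> a u ha Bu; rewrite -mulrA; exact: JM.
have [B0 BD BM] := mB.
suff : B 1 by rewrite /B mul1r.
have Jmul u1 u2 u3 : gen2 g Y D1 (line l m) u1 -> gen2 g Y D2 (line l m) u2 ->
    gen2 g Y D3 (line l m) u3 -> J (u1 * u2 * u3).
  by move=> h1 h2 h3; do 2!apply: mem_imul => //.
have lE := mem_gen2r g Y.
have DE := mem_gen2l g Y.
have B12 : B (D1 * D2) by apply: Jmul.
have B13 : B (D1 * D3).
  by rewrite /B -mulrA (mulrC D3) mulrA; apply: Jmul.
have B23 : B (D2 * D3).
  by rewrite /B mulrC mulrA; apply: Jmul.
have B1 : B (line l m * D1).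
  by rewrite /B (mulrC _ D1); apply: Jmul.
have B2 : B (line l m * D2) by apply: Jmul.
have B3 : B (line l m * D3).
  by rewrite /B -mulrA (mulrC D3) mulrA; apply: Jmul.
have Bl : B (line l m ^+ 2) by rewrite /B expr2; apply: Jmul.
have Bl' : B (conj_line l m).
  rewrite /B mulrC nrm -mulN1r; apply: (JM); last exact: Jmul.
  by apply: polyfunN; exact: polyfun1.
have [e12|n12] := eqVneq x1 x2.
  apply: (unit_of_double (x0 := x1) (x3 := x3) mB _ Bl' Bl) => //.
    by move: lm; rewrite -e12.
  by move: B12; rewrite /D2 -e12.
have [e13|n13] := eqVneq x1 x3.
  apply: (unit_of_double (x0 := x1) (x3 := x2) mB _ Bl' Bl) => //.
    by apply: line_meetsC13; apply: line_meetsC12; rewrite {2}e13.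
  by move: B13; rewrite /D3 -e13.
have [e23|n23] := eqVneq x2 x3.
  apply: (unit_of_double (x0 := x2) (x3 := x1) mB _ Bl' Bl) => //.
    by apply: line_meetsC13; rewrite {2}e23.
  by move: B23; rewrite /D3 -e23.
(* For distinct abscissas, Lagrange interpolation writes the Vandermonde constant k as a combination
   of the products [D2 * D3], [D1 * D3] and [D1 * D2]. *)
pose k := (x1 - x2) * (x1 - x3) * (x2 - x3).
apply: (@submodule_const _ _ _ _ k B _ _ mB).
  by rewrite !mulf_neq0 // subr_eq0.
have -> : c k * 1 = c (x2 - x3) * (D2 * D3) + (c (x3 - x1) * (D1 * D3)
     + c (x1 - x2) * (D1 * D2)).
  rewrite /k /D1 /D2 /D3 !(polyCB, polyCM).
  by rewrite !(rmorphB, rmorphM) /=; ring.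
by apply: (BD); [|apply: (BD)]; apply: (BM) => //; exact: polyfun_g.
Qed.

End LineIdeal.

(** * Classes of point ideals: associativity and relations between slopes *)

Section PointIdeals.
Variables (K : fieldType) (E : weierstrass K) (L : fieldType).
Variables (g : {rmorphism {poly K} -> L}) (Y : L).
Hypothesis model : coord_model E g Y.
Hypothesis disc0 : discriminant E != 0.

Local Notation polyfun := (polyfun g Y).
Local Notation X := (g 'X).
Local Notation c k := (g k%:P).
Local Notation prin := (prin g Y).
Local Notation pideal := (pideal g Y).
Local Notation line := (line g Y).
Local Notation polyxy := (polyxy g Y).

Lemma XsubC_neq0 k : X - c k != 0.
Proof.
rewrite -rmorphB -(polyxyX g Y); apply/eqP => /(model_free model) [] /eqP.
by rewrite polyXsubC_eq0.
Qed.

Lemma line_polyxy l m : line l m = polyxy (- (l *: 'X + m%:P)) 1.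
Proof.
rewrite /line /polyxy rmorph1 mul1r -mul_polyC rmorphN rmorphD rmorphM; ring.
Qed.

Lemma line_neq0 l m : line l m != 0.
Proof.
rewrite line_polyxy; apply/eqP => /(model_free model) [_] /eqP.
by rewrite oner_eq0.
Qed.

(* A generator would have a norm dividing [('X - x) ^+ 2], hence would be a
   polynomial in x, and then a constant since [Y - y] is a multiple of it. *)
Lemma pideal_not_prin x y z : on_curve E (Some (x, y)) ->
  pideal (Some (x, y)) <> prin z.
Proof.
move=> xyE Iz.
have [a ha Xz] : prin z (X - c x) by rewrite -Iz; exact: mem_gen2l.
have [b hb Yz] : prin z (Y - c y) by rewrite -Iz; exact: mem_gen2r.
have : pideal (Some (x, y)) z by rewrite Iz; exact: mem_prin.
case=> u [v [hu hv zE]].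
have hz : polyfun z.
  rewrite zE; apply: polyfunD; apply: (polyfunM model) => //.
    by rewrite -rmorphB; exact: polyfun_g.
  by apply: polyfunB; [exact: polyfun_y|exact: polyfun_g].
case: hz ha hb Xz Yz => p [q zpq] [pa [qa ->]] [pb [qb ->]].
have -> : X - c x = polyxy ('X - x%:P) 0 by rewrite polyxyX rmorphB.
have -> : Y - c y = polyxy (- y%:P) 1.
  by rewrite /polyxy rmorph1 mul1r rmorphN addrC.
rewrite zpq !(polyxyM model) => /(polyxy_inj model) [e1 e2] /(polyxy_inj model) [_ e3].
have nX := normM E pa qa p q.
rewrite -e1 -e2 in nX; move: nX; rewrite {1}/norm mulr0 mul0r expr0n mul0r !subr0 => nX.
have q0 : q = 0.
  apply/eqP/negPn/negP => q0; have := size_norm E p q0.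
  have nz : norm E pa qa * norm E p q != 0.
    by rewrite -nX expf_neq0 // polyXsubC_eq0.
  have := congr1 (fun r : {poly K} => size r) nX.
  rewrite expr2 size_mul ?polyXsubC_eq0 // size_XsubC /=.
  rewrite size_mul; last 2 first.
  - by apply: contraNneq nz => ->; rewrite mul0r.
  - by apply: contraNneq nz => ->; rewrite mulr0.
  have : (0 < size (norm E pa qa))%N.
    by rewrite size_poly_gt0; apply: contraNneq nz => ->; rewrite mul0r.
  case: (size (norm E pa qa)) => // n _.
  by case: (size (norm E p q)) => [|[|[|[|k]]]] //; rewrite !addnS.
move: e3; rewrite q0 mulr0 mulr0 mul0r add0r subr0 => qbp.
have p1 : size p == 1%N.
  by rewrite -dvdp1; apply/dvdpP; exists qb.
move/size_poly1P: p1 => [k k0 pE].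
have : value_at g Y x y z 0.
  have [w hw] := value_at_polyfun x y hu; have [w' hw'] := value_at_polyfun x y hv.
  rewrite zE -[Z in value_at _ _ _ _ _ Z](addr0 0); apply: value_atD.
    rewrite -[Z in value_at _ _ _ _ _ Z](mulr0 w); apply: (value_atM model) => //.
    have := value_at_poly g Y x y ('X - x%:P).
    by rewrite rmorphB hornerXsubC subrr.
  rewrite -[Z in value_at _ _ _ _ _ Z](mulr0 w'); apply: (value_atM model) => //.
  rewrite -[Z in value_at _ _ _ _ _ Z](subrr y); apply: value_atD; first exact: value_at_y.
  by apply: value_atN; have := value_at_poly g Y x y y%:P; rewrite hornerC.
have : value_at g Y x y z k.
  by exists p, q; rewrite zpq q0 pE horner0 hornerC mul0r addr0.
move=> h1 h2; have := value_at_fun model h1 h2 => kE.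
by rewrite kE eqxx in k0.
Qed.

Lemma pideal_oppE P : on_curve E P ->
  exists2 w, w != 0 & imul (pideal P) (pideal (popp E P)) = prin w.
Proof.
case: P => [[x y]|] PE.
  by exists (X - c x); [exact: XsubC_neq0|exact: pideal_opp].
by exists 1; rewrite ?oner_neq0 // (imul_prin model) mulr1.
Qed.

Lemma prin_cancel u I J : u != 0 -> submodule g Y I ->
  imul (prin u) I = J -> I = imul (prin u^-1) J.
Proof.
move=> u0 mI <-; rewrite imulA (imul_prin model) mulVf //.
by rewrite imul1.
Qed.

(* The divisor of [add_fun P Q] is [P] + [Q] - [P + Q] - [O]. *)
Definition add_fun (P Q : point K) : L :=
  match P, Q with
  | Some (x1, y1), Some (x2, y2) =>
    if padd E P Q is Some (x3, _)
    then line (slope E P Q) (y1 - slope E P Q * x1) / (X - c x3)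
    else X - c x1
  | _, _ => 1
  end.

Lemma add_fun_neq0 P Q : add_fun P Q != 0.
Proof.
case: P => [[x1 y1]|]; case: Q => [[x2 y2]|]; rewrite ?oner_neq0 //=.
case: ifP => _; first exact: XsubC_neq0.
by rewrite mulf_neq0 ?invr_eq0 ?line_neq0 ?XsubC_neq0.
Qed.

(** In the generic case, multiply the relation of [pideal_collinear] by the ideal of P + Q, which is
    opposite to the third point of the line, and cancel the vertical line through these two. *)
Lemma pideal_add P Q : on_curve E P -> on_curve E Q ->
  imul (pideal P) (pideal Q) = imul (prin (add_fun P Q)) (pideal (padd E P Q)).
Proof.
case: P => [[x1 y1]|]; last by [].
case: Q => [[x2 y2]|]; last first.
  by move=> _ _; rewrite [LHS]imulC.
move=> c1 c2; have [QE|npp] := eqVneq (Some (x2, y2)) (popp E (Some (x1, y1))).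
  rewrite QE /add_fun {1}/popp /padd -/(popp E (Some (x1, y1))) eqxx.
  rewrite (pideal_opp model disc0 c1) (imul_prin model).
  by rewrite mulr1.
have [lm y2E] := slope_line c1 c2 npp.
rewrite /add_fun; have := padd_slope npp.
set l := slope E _ _ in lm y2E *; set x3 := _ - x1 - x2 in lm y2E *.
set m := y1 - l * x1 in lm y2E *.
move=> ->.
have y1E : y1 = l * x1 + m by rewrite /m; ring.
have c3 := line_meets_on_curve (line_meetsC13 lm).
have := pideal_collinear model disc0 lm; rewrite -y1E -y2E.
move/(congr1 (fun I => imul I (pideal (popp E (Some (x3, l * x3 + m)))))).
rewrite -imulA (pideal_opp model disc0 c3) imulC.
move/(prin_cancel (XsubC_neq0 x3)) => -> //.
  by rewrite imulA (imul_prin model) mulrC.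
by apply: submodule_imul; exact: (submodule_pideal model).
Qed.

Lemma padd_eqO P Q : padd E P Q = None -> Q = popp E P.
Proof.
case: P => [[x1 y1]|] //; case: Q => [[x2 y2]|] // h.
by apply/eqP; apply: contraPT h => npp; rewrite padd_slope.
Qed.

Lemma paddN P : padd E P (popp E P) = None.
Proof. by case: P => [[x y]|] //; rewrite /padd eqxx. Qed.

(** Multiplying both sides by the ideal of - Q makes the ideal of P - Q principal, which
    [pideal_not_prin] allows only for P - Q = O. *)
Lemma pideal_class u v P Q : u != 0 -> v != 0 -> on_curve E P -> on_curve E Q ->
  imul (prin u) (pideal P) = imul (prin v) (pideal Q) -> P = Q.
Proof.
move=> u0 v0 PE QE.
move/(congr1 (fun I => imul I (pideal (popp E Q)))).
have QE' : on_curve E (popp E Q) by rewrite on_curve_popp.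
rewrite -!imulA pideal_add //; have [w w0 ->] := pideal_oppE QE.
rewrite imulA !(imul_prin model) => h.
have := prin_cancel (mulf_neq0 u0 (add_fun_neq0 P (popp E Q))) (submodule_pideal model _) h.
rewrite (imul_prin model); have : on_curve E (padd E P (popp E Q)).
  exact: on_curve_padd.
case e : (padd E P (popp E Q)) => [[x y]|].
  by move=> xyE /pideal_not_prin; case.
by move=> _ _; rewrite -[P](poppK E) -(padd_eqO e) poppK.
Qed.

Lemma paddC P Q : on_curve E P -> on_curve E Q -> padd E P Q = padd E Q P.
Proof.
move=> PE QE; apply: (pideal_class (add_fun_neq0 P Q) (add_fun_neq0 Q P)).
- exact: on_curve_padd.
- exact: on_curve_padd.
- by rewrite -!pideal_add // imulC.
Qed.

Lemma imul3_add P Q R : on_curve E P -> on_curve E Q -> on_curve E R ->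
  imul (imul (pideal P) (pideal Q)) (pideal R)
  = imul (prin (add_fun P Q * add_fun (padd E P Q) R))
         (pideal (padd E (padd E P Q) R)).
Proof.
move=> PE QE RE; rewrite pideal_add // -imulA pideal_add ?on_curve_padd //.
by rewrite imulA (imul_prin model).
Qed.

Lemma imul3_add' P Q R : on_curve E P -> on_curve E Q -> on_curve E R ->
  imul (imul (pideal P) (pideal Q)) (pideal R)
  = imul (prin (add_fun Q R * add_fun P (padd E Q R)))
         (pideal (padd E P (padd E Q R))).
Proof.
move=> PE QE RE; rewrite -imulA (pideal_add QE RE) imulC -imulA imulC.
rewrite (imulC (pideal _)) pideal_add ?on_curve_padd //.
by rewrite imulC imulA (imul_prin model).
Qed.

(** The ideals of both sides lie in the class of the product of the ideals of P, Q and R, and a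
    class determines its point. *)
Lemma paddA P Q R : on_curve E P -> on_curve E Q -> on_curve E R ->
  padd E P (padd E Q R) = padd E (padd E P Q) R.
Proof.
move=> PE QE RE; have := imul3_add PE QE RE; rewrite imul3_add' // => h.
by apply: (pideal_class _ _ _ _ h); rewrite ?on_curve_padd ?mulf_neq0 ?add_fun_neq0.
Qed.

(** The triple product of ideals factors in two ways with the same ideal of P + Q + R. Once this is
    cancelled, two generators of one principal ideal remain. *)
Lemma add_fun_cocycle P Q R : on_curve E P -> on_curve E Q -> on_curve E R ->
  exists2 k, k != 0 & add_fun P Q * add_fun (padd E P Q) R
   = c k * (add_fun Q R * add_fun P (padd E Q R)).
Proof.
move=> PE QE RE; have := imul3_add PE QE RE; rewrite imul3_add' // paddA //.
set S := padd E (padd E P Q) R; move/(congr1 (fun I => imul I (pideal (popp E S)))).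
have SE : on_curve E S by rewrite !on_curve_padd.
have [w w0 wE] := pideal_oppE SE.
rewrite -!imulA wE !(imul_prin model) => /esym h.
have [|k k0 kE] := prin_eq model _ h; first by rewrite !mulf_neq0 ?add_fun_neq0.
by exists k => //; apply: (mulIf w0); rewrite kE mulrA.
Qed.

Lemma line_mul l1 m1 l2 m2 : line l1 m1 * line l2 m2 =
  polyxy (cub_poly E + (l1 * l2) *: 'X^2 + (l1 * m2 + l2 * m1) *: 'X + (m1 * m2)%:P)
        (- ((l1 + l2 + a1 E) *: 'X + (m1 + m2 + a3 E)%:P)).
Proof.
rewrite !line_polyxy (polyxyM model); congr (polyxy _ _).
  by rewrite -!mul_polyC !(polyCD, polyCM); ring.
by rewrite /lin_poly -!mul_polyC !(polyCD, polyCM); ring.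
Qed.

Lemma polyxy_mulg p q s : polyxy p q * g s = polyxy (p * s) (q * s).
Proof. by rewrite /polyxy !rmorphM; ring. Qed.

(** In the form p + q Y, the coefficient of x^4 in p gives k = 1, and then the coefficient of x^2 in
    q compares the sums of slopes. *)
Lemma line_product_slopes l1 m1 l2 m2 l3 m3 l4 m4 r s k :
  line l1 m1 * line l2 m2 * (X - c r) = c k * (line l3 m3 * line l4 m4 * (X - c s)) ->
  l1 + l2 = l3 + l4.
Proof.
rewrite [c k * _]mulrC !line_mul -!rmorphB !polyxy_mulg => /(polyxy_inj model).
case=> e1 e2.
have := congr1 (fun p : {poly K} => p`_4) e1.
have := congr1 (fun p : {poly K} => p`_2) e2.
rewrite /= !coefMC !mulrBr !coefB !coefMX !coefMC /cub_poly !coefE /=.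
rewrite !(mulr0, mulr1, addr0, mul0r, subr0, add0r, oppr0, mul1r).
move=> + k1; rewrite -k1 mulr1 => e.
by apply/eqP; rewrite -(inj_eq (addIr (a1 E))) -eqr_opp e.
Qed.

Lemma line_product_opp l1 m1 l2 m2 p k :
  line l1 m1 * line l2 m2 = c k * g p -> l1 + l2 + a1 E = 0.
Proof.
rewrite -rmorphM -(polyxyX g Y) line_mul => /(polyxy_inj model) [_].
move/(congr1 (fun p : {poly K} => p`_1)); rewrite /= !coefE /=.
by rewrite mulr1 addr0 => /eqP; rewrite oppr_eq0 => /eqP.
Qed.

Lemma slope_cocycle P Q R : on_curve E P -> on_curve E Q -> on_curve E R ->
  P <> None -> Q <> None -> R <> None -> padd E P Q <> None ->
  padd E Q R <> None -> padd E (padd E P Q) R <> None ->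
  slope E P Q + slope E (padd E P Q) R = slope E Q R + slope E P (padd E Q R).
Proof.
move=> PE QE RE P0 Q0 R0 PQ0 QR0 S0.
have [k k0] := add_fun_cocycle PE QE RE; move: S0 (paddA PE QE RE).
rewrite /add_fun.
case: P P0 PE PQ0 => [[x1 y1]|] // _ PE; case: Q Q0 QE QR0 => [[x2 y2]|] // _ QE.
case: R R0 RE => [[x3 y3]|] // _ RE.
case: (padd E (Some (x2, y2)) _) => [[x5 y5]|] // _.
case: (padd E (Some (x1, y1)) (Some (x2, y2))) => [[x4 y4]|] // _.
case: (padd E (Some (x4, y4)) _) => [[x6 y6]|] // _ ->.
(* Clear denominators; the vertical through P + Q + R, of abscissa [x6], occurs on both sides and
   cancels. *)
move=> h; suff h' : forall l1 l2 l3 l4, l1 / (X - c x4) * (l2 / (X - c x6))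
    = c k * (l3 / (X - c x5) * (l4 / (X - c x6))) ->
    l1 * l2 * (X - c x5) = c k * (l3 * l4 * (X - c x4)).
  exact: line_product_slopes (h' _ _ _ _ h).
move=> u1 u2 u3 u4 {h}; move: (XsubC_neq0 x4) (XsubC_neq0 x5) (XsubC_neq0 x6).
move: (X - c x4) (X - c x5) (X - c x6) (c k) => D4 D5 D6 k' n4 n5 n6 h.
apply: (mulIf (invr_neq0 n6)); apply: (mulIf (invr_neq0 n4)).
transitivity ((u1 / D4 * (u2 / D6)) * D5); first by ring.
by rewrite h; field; rewrite n4 n5 n6.
Qed.

(** The relation [add_fun_cocycle] for P, Q, - Q: its right-hand side involves only a vertical line,
    so the Y-component of the product of the two lines is zero. *)
Lemma slope_oppr P Q : on_curve E P -> on_curve E Q ->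
  P <> None -> Q <> None -> padd E P Q <> None ->
  slope E (padd E P Q) (popp E Q) = - slope E P Q - a1 E.
Proof.
move=> PE QE P0 Q0 PQ0; have QE' : on_curve E (popp E Q) by rewrite on_curve_popp.
have [k k0] := add_fun_cocycle PE QE QE'; move: (paddA PE QE QE').
rewrite paddN; case: P P0 PE PQ0 => [[x1 y1]|] // _ PE.
case: Q Q0 QE QE' => [[x2 y2]|] // _ QE QE'.
rewrite {2 3}/add_fun paddN; have -> : padd E (Some (x1, y1)) None = Some (x1, y1) by [].
rewrite /add_fun /popp -/(popp E (Some (x2, y2))).
case: (padd E (Some (x1, y1)) (Some (x2, y2))) => [[x4 y4]|] // _ <-.
move=> h; set l := slope E (Some (x4, _)) _ in h *; set l' := slope E _ _ in h *.
suff h' : forall l1 l2, l1 / (X - c x4) * (l2 / (X - c x1)) = c k * ((X - c x2) * 1) ->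
    l1 * l2 = c k * g (('X - x2%:P) * ('X - x4%:P) * ('X - x1%:P)).
  apply/eqP; rewrite -subr_eq0; apply/eqP.
  by rewrite -[RHS](line_product_opp (h' _ _ h)); ring.
move=> u1 u2 {h}; rewrite !(rmorphB, rmorphM).
move: (XsubC_neq0 x4) (XsubC_neq0 x1).
move: (X - c x1) (X - c x2) (X - c x4) (c k) => D1 D2 D4 k' n4 n1 h.
apply: (mulIf (invr_neq0 n1)); apply: (mulIf (invr_neq0 n4)).
transitivity (u1 / D4 * (u2 / D1)); first by ring.
by rewrite h; field; rewrite n4 n1.
Qed.

End PointIdeals.

(** * Straight-line programs *)

Section Programs.
Variables (K : fieldType) (n : nat).
Implicit Types (s : seq (operation K)) (f : seq K -> K).

Definition run s (r : seq K) : seq K :=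
  foldl (fun r op => rcons r (operation_val r op)) r s.

Lemma run_cat s s' r : run (s ++ s') r = run s' (run s r).
Proof. exact: foldl_cat. Qed.

Lemma size_run s r : size (run s r) = (size r + size s)%N.
Proof.
elim: s r => [|op s IH] r; first by rewrite addn0.
by rewrite /run /= -/(run s _) IH size_rcons addSnnS.
Qed.

Lemma nth_run s r i : (i < size r)%N -> nth 0 (run s r) i = nth 0 r i.
Proof.
elim: s r => [|op s IH] r // lt_ir.
by rewrite /run /= -/(run s _) IH ?size_rcons ?nth_rcons ?lt_ir // ltnW.
Qed.

Lemma body_ok_cat m s s' :
  body_ok m (s ++ s') = body_ok m s && body_ok (m + size s) s'.
Proof.
elim: s m => [|op s IH] m /=; first by rewrite addn0.
by rewrite IH addSnnS andbA.
Qed.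

(* After the operations s, some operand holds the value of f at the input. *)
Definition avail s f : Prop := exists2 o, operand_ok (n + size s) o &
  forall inp, size inp = n -> operand_val (run s inp) o = f inp.

Lemma avail_ext s f f' : f =1 f' -> avail s f -> avail s f'.
Proof. by move=> ff' [o oo oE]; exists o => // inp /oE ->. Qed.

Lemma avail_cat s s' f : avail s f -> avail (s ++ s') f.
Proof.
case=> o oo oE; exists o.
  by case: o oo {oE} => //= i; rewrite size_cat; lia.
move=> inp sz; rewrite -oE // run_cat.
case: o oo {oE} => //= i lt_i; rewrite nth_run //.
by rewrite size_run sz.
Qed.

Lemma avail_input s i : (i < n)%N -> avail s (fun inp => nth 0 inp i).
Proof.
move=> lt_in; exists (Reg K i) => /=; first by lia.
by move=> inp sz; rewrite nth_run ?sz.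
Qed.

(* The program s' extends s by at most k operations. *)
Definition reach (k : nat) s s' : Prop :=
  body_ok n s' /\ exists2 s1, s' = s ++ s1 & (size s1 <= k)%N.

Lemma reach0 s : body_ok n s -> reach 0 s s.
Proof. by move=> hs; split=> //; exists [::]; rewrite ?cats0. Qed.

Lemma reachW k k' s s' : (k <= k')%N -> reach k s s' -> reach k' s s'.
Proof. by move=> le_k [hs [s1 eq_s hs1]]; split=> //; exists s1 => //; lia. Qed.

Lemma reach_trans k k' s s' s'' :
  reach k s s' -> reach k' s' s'' -> reach (k + k') s s''.
Proof.
case=> _ [s1 -> le1] [hs'' [s2 eq_s le2]]; split=> //; rewrite eq_s.
by exists (s1 ++ s2); rewrite -?catA // size_cat leq_add.
Qed.

Lemma avail_reach k s s' f : reach k s s' -> avail s f -> avail s' f.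
Proof. by case=> _ [s1 -> _]; exact: avail_cat. Qed.

Lemma reach_ok k s s' : reach k s s' -> body_ok n s'.
Proof. by case. Qed.

Lemma reach_op s op f : body_ok n s -> operation_ok (n + size s) op ->
  (forall inp, size inp = n -> operation_val (run s inp) op = f inp) ->
  exists2 s', reach 1 s s' & avail s' f.
Proof.
move=> hs hop opE; exists (s ++ [:: op]).
  by split; [rewrite body_ok_cat hs /= hop|exists [:: op]].
exists (Reg K (n + size s)) => /=; first by rewrite size_cat /=; lia.
move=> inp sz; rewrite run_cat /= nth_rcons size_run sz ltnn eqxx; exact: opE.
Qed.

Lemma reach_scale s a f : body_ok n s -> avail s f ->
  exists2 s', reach 1 s s' & avail s' (fun inp => a * f inp).
Proof.
move=> hs [o oo oE]; apply: (@reach_op s (Scale a o)) => // inp sz /=.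
by rewrite oE.
Qed.

Lemma reach_add s f1 f2 : body_ok n s -> avail s f1 -> avail s f2 ->
  exists2 s', reach 1 s s' & avail s' (fun inp => f1 inp + f2 inp).
Proof.
move=> hs [o oo oE] [o' oo' oE']; apply: (@reach_op s (Add o o')) => //=.
  by rewrite oo.
by move=> inp sz /=; rewrite oE // oE'.
Qed.

Lemma reach_lin2 s a1 a2 f1 f2 : body_ok n s -> avail s f1 -> avail s f2 ->
  exists2 s', reach 3 s s' & avail s' (fun inp => a1 * f1 inp + a2 * f2 inp).
Proof.
move=> hs h1 h2; have [s1 r1 A1] := reach_scale a1 hs h1.
have [s2 r2 A2] := reach_scale a2 (reach_ok r1) (avail_reach r1 h2).
have [s3 r3 A3] := reach_add (reach_ok r2) (avail_reach r2 A1) A2.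
by exists s3 => //; exact: (reach_trans r1 (reach_trans r2 r3)).
Qed.

Lemma reach_sum s (I : seq nat) (a : nat -> K) (f : nat -> seq K -> K) :
  body_ok n s -> (forall i, i \in I -> avail s (f i)) ->
  exists2 s', reach (2 * size I) s s' &
    avail s' (fun inp => \sum_(i <- I) a i * f i inp).
Proof.
elim: I s => [|i I IH] s hs hf.
  by exists s; [exact: reach0|exists (Cst 0) => // inp _; rewrite big_nil].
have [|s1 r1 A1] := IH s hs; first by move=> j jI; apply: hf; rewrite inE jI orbT.
have hfi : avail s1 (f i) by apply: (avail_reach r1); apply: hf; rewrite mem_head.
have [s2 r2 A2] := reach_scale (a i) (reach_ok r1) hfi.
have [s3 r3 A3] := reach_add (reach_ok r2) A2 (avail_reach r2 A1).
exists s3.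
  by apply: reachW (reach_trans r1 (reach_trans r2 r3)); rewrite /=; lia.
by apply: avail_ext A3 => inp; rewrite big_cons.
Qed.

(** The hypothesis ranges over all extensions of s, so that each member of the family can be
    computed after the preceding ones. *)
Lemma reach_family k m (F : nat -> seq K -> K) s : body_ok n s ->
  (forall s1 k1 i, reach k1 s s1 -> (i < m)%N ->
     exists2 s2, reach k s1 s2 & avail s2 (F i)) ->
  exists2 s', reach (m * k) s s' & forall i, (i < m)%N -> avail s' (F i).
Proof.
move=> hs; elim: m => [|m IH] hF; first by exists s => //; exact: reach0.
have [|s1 r1 A1] := IH; first by move=> s1 k1 i r1 lt_im; apply: hF r1 _; lia.
have [s2 r2 A2] := hF s1 _ m r1 (ltnSn m).
exists s2; first by apply: reachW (reach_trans r1 r2); rewrite mulSn addnC.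
move=> i; rewrite ltnS leq_eqVlt => /predU1P [-> //|/A1].
exact: (avail_reach r2).
Qed.

End Programs.

(** * Slope systems and their quotients *)

Section SlopeSystems.
Variables (G : zmodType) (K : fieldType).

(** Up to sign these are the three points of the line through P and Q; keeping them off H keeps its
    slope finite. *)
Definition generic (H : pred G) (P Q : G) : bool :=
  [&& ~~ H P, ~~ H Q & ~~ H (P + Q)].

(* The properties of abscissas, ordinates and slopes that survive the quotient
   by H; these functions are meaningful only off the subgroup H, which is {O} for
   the curve itself. *)
Record slope_system (H : pred G) (x y : G -> K) (lam : G -> G -> K) (c : K) :
  Prop := SlopeSystem {
    sys0 : H 0;
    sysB : forall P Q, H P -> H Q -> H (P - Q);
    sys_x : forall P A, H A -> x (P + A) = x P;
    sys_y : forall P A, H A -> ~~ H P -> y (P + A) = y P;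
    sys_lam : forall P Q A, H A -> generic H P Q -> lam (P + A) Q = lam P Q;
    sys_xN : forall P, x (- P) = x P;
    sys_yN : forall P, ~~ H P -> y (- P) = - y P;
    sys_lamC : forall P Q, generic H P Q -> lam P Q = lam Q P;
    sys_lam_opp : forall P Q, generic H P Q -> lam (P + Q) (- Q) = - lam P Q;
    sys_cocycle : forall P Q R, generic H P Q -> generic H Q R ->
      ~~ H R -> ~~ H (P + Q + R) ->
      lam P Q + lam (P + Q) R = lam Q R + lam P (Q + R);
    sys_square : forall P Q, generic H P Q ->
      lam P Q ^+ 2 = x P + x Q + x (P + Q) + c;
    sys_chord : forall P Q, generic H P Q ->
      (x P - x Q) * lam P Q = y P - y Q;
    sys_y_neq0 : forall P, ~~ H (P + P) -> y P != 0 }.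

Section Subgroup.
Variable H : pred G.
Hypotheses (H0 : H 0) (HB : forall P Q, H P -> H Q -> H (P - Q)).

Lemma subN P : H (- P) = H P.
Proof.
have HN Q : H Q -> H (- Q) by rewrite -sub0r; exact: HB.
by apply/idP/idP => /HN //; rewrite opprK.
Qed.

Lemma subD P A : H A -> H (P + A) = H P.
Proof.
move=> HA; apply/idP/idP => h; first by rewrite -(addrK A P); exact: HB.
by rewrite -[A]opprK; apply: HB; rewrite ?subN.
Qed.

Lemma genericC P Q : generic H P Q = generic H Q P.
Proof. by rewrite /generic addrC andbCA. Qed.

Lemma genericN P Q : generic H (- P) (- Q) = generic H P Q.
Proof. by rewrite /generic -opprD !subN. Qed.

Lemma generic_opp P Q : generic H (P + Q) (- Q) = generic H P Q.
Proof. by rewrite /generic addrK subN andbC -andbA andbC andbAC andbA. Qed.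
End Subgroup.

Section Consequences.
Variables (H : pred G) (x y : G -> K) (lam : G -> G -> K) (c : K).
Hypothesis S : slope_system H x y lam c.

Let H0 := sys0 S.
Let HB := @sysB _ _ _ _ _ S.

Lemma sys_lamr P Q A : H A -> generic H P Q -> lam P (Q + A) = lam P Q.
Proof.
move=> HA gPQ; have gQP : generic H Q P by rewrite genericC.
rewrite (sys_lamC S) ?(sys_lam S) // ?(sys_lamC S gQP) //.
by move: gPQ; rewrite /generic addrA !(subD H0 HB _ HA).
Qed.

(** A slope belongs to the line, hence to any two of its three points P, Q, - (P + Q). Formally this
    is [sys_lam_opp] used twice. *)
Lemma sys_lam_third P Q : generic H P Q -> lam Q (- (P + Q)) = lam P Q.
Proof.
move=> gPQ; have gQP : generic H Q P by rewrite genericC.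
have g1 : generic H (P + Q) (- P) by rewrite addrC (generic_opp H0 HB).
have e1 : lam (P + Q) (- P) = - lam P Q.
  by rewrite [P + Q]addrC (sys_lam_opp S gQP) (sys_lamC S gPQ).
have g2 : generic H (- P) (P + Q) by rewrite genericC.
by have := sys_lam_opp S g2; rewrite addKr (sys_lamC S g2) e1 opprK.
Qed.

Lemma sys_lamN P Q : generic H P Q -> lam (- P) (- Q) = - lam P Q.
Proof.
move=> gPQ; have g3 : generic H (- (P + Q)) Q.
  by rewrite -[Q in generic _ _ Q]opprK (genericN H0 HB) (generic_opp H0 HB).
have := sys_lam_opp S g3; rewrite opprD subrK => ->.
by rewrite -opprD (sys_lamC S g3) sys_lam_third.
Qed.

End Consequences.

(** * The quotient by a point of order two *)

Section Quotient.
Variables (H : pred G) (x y : G -> K) (lam : G -> G -> K) (c : K) (T : G).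
Hypothesis S : slope_system H x y lam c.
Hypothesis two_neq0 : (2 : K) != 0.
Hypotheses (HT : ~~ H T) (HTT : H (T + T)).

Let H0 := sys0 S.
Let HB := @sysB _ _ _ _ _ S.

(* The subgroup generated by H and T, and the slope system of the quotient. *)
Definition quo_pred : pred G := fun P => H P || H (P - T).
Definition quo_h (P : G) : K := lam P T.
Definition quo_gap (P : G) : K := x P - x (P + T).
Definition quo_x (P : G) : K := x P + x (P + T).
Definition quo_y (P : G) : K := quo_h P * quo_gap P.
Definition quo_lam (P Q : G) : K :=
  2 * lam P Q + quo_h (P + Q) - quo_h P - quo_h Q.
Definition quo_const : K := c - 3 * x T.

Local Notation H' := quo_pred.
Local Notation h := quo_h.
Local Notation gap := quo_gap.

Lemma subBT P : H (P - T) = H (P + T).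
Proof. by rewrite -(subD H0 HB _ HTT) addrA subrK. Qed.

Lemma quo_predE P : H' P = H P || H (P + T).
Proof. by rewrite /quo_pred subBT. Qed.

Lemma quo_notin P : ~~ H' P -> ~~ H P /\ ~~ H (P + T).
Proof. by rewrite quo_predE negb_or => /andP. Qed.

Lemma quo_pred0 : H' 0.
Proof. by rewrite /quo_pred H0. Qed.

Lemma quo_predT : H' T.
Proof. by rewrite /quo_pred subrr H0 orbT. Qed.

Lemma quo_predB P Q : H' P -> H' Q -> H' (P - Q).
Proof.
rewrite /quo_pred => /orP [hP|hP] /orP [hQ|hQ].
- by rewrite HB.
- have -> : P - Q - T = P - (Q - T) - (T + T).
    by rewrite opprB addrA (addrAC P) opprD addrA addrK.
  by apply/orP; right; do 2?apply: (HB).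
- by rewrite addrAC [X in _ || X]HB ?orbT.
- have -> : P - Q = P - T - (Q - T) by rewrite opprB addrA subrK.
  by rewrite HB.
Qed.

Lemma quo_predDT P : H' (P + T) = H' P.
Proof. exact: (subD quo_pred0 quo_predB _ quo_predT). Qed.

Lemma generic_quo P Q : generic H' P Q ->
  [/\ generic H P Q, generic H P T, generic H Q T & generic H (P + Q) T].
Proof.
by case/and3P=> /quo_notin [? ?] /quo_notin [? ?] /quo_notin [? ?]; split; apply/and3P.
Qed.

Lemma generic_T P : ~~ H' P -> generic H P T.
Proof. by case/quo_notin=> ? ?; apply/and3P. Qed.

Lemma notin_quo_double P : ~~ H (P + P) -> ~~ H' P.
Proof.
have HD Q : H Q -> H (Q + Q) by move=> hQ; rewrite (subD H0 HB).
apply: contra => /orP [/HD //|/HD].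
rewrite addrACA -opprD => hPP.
by rewrite -(subrK (T + T) (P + P)) (subD H0 HB).
Qed.

Lemma quo_lam_oppT P : generic H P T -> lam P (- T) = h P.
Proof.
move=> g; have -> : - T = T - (T + T) by rewrite opprD addrA subrr add0r.
by rewrite (sys_lamr S) // (subN H0 HB).
Qed.

(** As - T and T agree modulo H, this is [sys_lam_opp] with Q = T. *)
Lemma quo_hD P : ~~ H' P -> h (P + T) = - h P.
Proof.
move=> hP; rewrite -(quo_lam_oppT (P := P + T)); last first.
  by apply: generic_T; rewrite quo_predDT.
by rewrite (sys_lam_opp S) // generic_T.
Qed.

Lemma quo_hN P : ~~ H' P -> h (- P) = - h P.
Proof.
move=> hP; rewrite -quo_lam_oppT ?(sys_lamN S) ?generic_T //.
by rewrite (subN quo_pred0 quo_predB).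
Qed.

(** The cocycle relation for the triple T, P, Q. *)
Lemma lam_shift P Q : generic H' P Q -> lam (P + T) Q = lam P Q + h (P + Q) - h P.
Proof.
move=> g; have [gPQ gPT gQT gPQT] := generic_quo g.
have gTP : generic H T P by rewrite genericC.
have := sys_cocycle S gTP gPQ; rewrite (sys_lamC S gTP) [lam T (P + Q)](sys_lamC S).
  rewrite [T + P]addrC -/(h P) -/(h (P + Q)) => e.
  apply/eqP; rewrite eq_sym subr_eq eq_sym addrC e //.
    by case/and3P: gPQ.
  by rewrite addrAC; case/and3P: gPQT.
by rewrite genericC.
Qed.

Lemma generic_quoDl P Q : generic H' (P + T) Q = generic H' P Q.
Proof. by rewrite /generic addrAC !quo_predDT. Qed.

Lemma lam_shiftr P Q : generic H' P Q -> lam P (Q + T) = lam P Q + h (P + Q) - h Q.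
Proof.
move=> g; have [gPQ _ _ _] := generic_quo g.
have g' : generic H' Q P by rewrite genericC.
have g2 : generic H' P (Q + T) by rewrite genericC generic_quoDl genericC.
have [gPQ2 _ _ _] := generic_quo g2.
by rewrite (sys_lamC S gPQ2) lam_shift // -(sys_lamC S gPQ) [Q + P]addrC.
Qed.

Lemma four_squares P Q (l := lam P Q) : generic H' P Q ->
  [/\ l ^+ 2 = x P + x Q + x (P + Q) + c,
      (l + h (P + Q) - h P) ^+ 2 = x (P + T) + x Q + x (P + Q + T) + c,
      (l + h (P + Q) - h Q) ^+ 2 = x P + x (Q + T) + x (P + Q + T) + c &
      (l - h P - h Q) ^+ 2 = x (P + T) + x (Q + T) + x (P + Q) + c].
Proof.
move=> g; have [gPQ _ _ _] := generic_quo g.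
have g1 : generic H' (P + T) Q by rewrite generic_quoDl.
have g2 : generic H' P (Q + T) by rewrite genericC generic_quoDl genericC.
have g3 : generic H' (P + T) (Q + T) by rewrite generic_quoDl.
have [gPQ1 _ _ _] := generic_quo g1; have [gPQ2 _ _ _] := generic_quo g2.
have [gPQ3 _ _ _] := generic_quo g3; have [nP nQ nPQ] := and3P g.
split; first exact: (sys_square S).
- by rewrite /l -lam_shift // (sys_square S) // [P + T + Q]addrAC.
- by rewrite /l -lam_shiftr // (sys_square S) // [P + (Q + T)]addrA.
- have -> : l - h P - h Q = lam (P + T) (Q + T).
    by rewrite lam_shiftr // lam_shift // [P + T + Q]addrAC !quo_hD // /l; ring.
  by rewrite (sys_square S) // [P + T + _]addrACA (sys_x S (P + Q) HTT).
Qed.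

Lemma quo_h_square P : ~~ H' P -> h P ^+ 2 = quo_x P + x T + c.
Proof.
by move=> hP; rewrite /quo_h (sys_square S) ?generic_T // /quo_x; ring.
Qed.

(* Alternating sum of the quadratic relation over (P, Q) + {0, T}^2. *)
Lemma quo_product P Q : generic H' P Q ->
  h P * h Q = h (P + Q) * quo_lam P Q + gap (P + Q).
Proof.
move=> g; have [s0 s1 s2 s3] := four_squares g.
apply: (mulfI two_neq0); rewrite /quo_lam /quo_gap.
move: s0 s1 s2 s3; move: (lam P Q) (h P) (h Q) (h (P + Q)) => l h1 h2 h3.
move=> s0 s1 s2 s3.
have e : l ^+ 2 + (l - h1 - h2) ^+ 2 - (l + h3 - h1) ^+ 2 - (l + h3 - h2) ^+ 2
   = 2 * (x (P + Q) - x (P + Q + T)) by rewrite s0 s1 s2 s3; ring.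
by rewrite mulrDr -e; ring.
Qed.

(** The sum of the relations of [four_squares], minus the squares of h at P, Q and P + Q, is a
    perfect square. *)
Lemma quo_square P Q : generic H' P Q ->
  quo_lam P Q ^+ 2 = quo_x P + quo_x Q + quo_x (P + Q) + quo_const.
Proof.
move=> g; have [s0 s1 s2 s3] := four_squares g; have [nP nQ nPQ] := and3P g.
have := (quo_h_square nP, quo_h_square nQ, quo_h_square nPQ).
rewrite /quo_x /quo_const /quo_lam => -[[]].
move: s0 s1 s2 s3; move: (lam P Q) (h P) (h Q) (h (P + Q)) => l h1 h2 h3.
move=> s0 s1 s2 s3 q1 q2 q3.
transitivity (l ^+ 2 + (l - h1 - h2) ^+ 2 + (l + h3 - h1) ^+ 2
  + (l + h3 - h2) ^+ 2 - h1 ^+ 2 - h2 ^+ 2 - h3 ^+ 2); first by ring.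
by rewrite s0 s1 s2 s3 q1 q2 q3; ring.
Qed.

Lemma quo_lamC P Q : generic H' P Q -> quo_lam P Q = quo_lam Q P.
Proof.
move=> g; have [gPQ _ _ _] := generic_quo g.
by rewrite /quo_lam (sys_lamC S gPQ) [Q + P]addrC addrAC.
Qed.

Lemma quo_lamDT P Q : generic H' P Q -> quo_lam (P + T) Q = quo_lam P Q.
Proof.
move=> g; have [nP nQ nPQ] := and3P g.
by rewrite /quo_lam lam_shift // [P + T + Q]addrAC !quo_hD //; ring.
Qed.

Lemma quo_lam_inv P Q A : H' A -> generic H' P Q -> quo_lam (P + A) Q = quo_lam P Q.
Proof.
have base B R : H B -> generic H' R Q -> quo_lam (R + B) Q = quo_lam R Q.
  move=> hB g; have [gPQ gPT gQT gPQT] := generic_quo g.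
  rewrite /quo_lam /quo_h [R + B + Q]addrAC (sys_lam S hB gPQ) (sys_lam S hB gPT).
  by rewrite (sys_lam S hB gPQT).
move=> /orP [hA|hA] g; first exact: base.
have gA : generic H' (P + (A - T)) Q.
  have hA' : H' (A - T) by rewrite /quo_pred hA.
  by rewrite /generic [_ + _ + Q]addrAC !(subD quo_pred0 quo_predB _ hA').
by rewrite -(subrK T A) addrA quo_lamDT // base.
Qed.

Lemma quo_lam_opp P Q : generic H' P Q -> quo_lam (P + Q) (- Q) = - quo_lam P Q.
Proof.
move=> g; have [nP nQ nPQ] := and3P g; have [gPQ _ _ _] := generic_quo g.
by rewrite /quo_lam (sys_lam_opp S) // addrK quo_hN //; ring.
Qed.

(** Applied to the pairs (P + Q, - Q) and (Q + P, - P), [quo_product] expresses the gaps at P and Q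
    through h and [quo_lam], while the abscissas differ by h(P)^2 - h(Q)^2. *)
Lemma quo_chord P Q : generic H' P Q ->
  (quo_x P - quo_x Q) * quo_lam P Q = quo_y P - quo_y Q.
Proof.
move=> g; have [nP nQ nPQ] := and3P g.
have g' : generic H' Q P by rewrite genericC.
have e1 : generic H' (P + Q) (- Q) by rewrite (generic_opp quo_pred0 quo_predB).
have e2 : generic H' (Q + P) (- P) by rewrite (generic_opp quo_pred0 quo_predB).
have := (quo_product e1, quo_product e2).
rewrite !addrK !quo_hN // !quo_lam_opp // (quo_lamC g') [Q + P]addrC => -[p1 p2].
have -> : quo_x P - quo_x Q = h P ^+ 2 - h Q ^+ 2 by rewrite !quo_h_square //; ring.
have g1 : gap P = h P * quo_lam P Q - h (P + Q) * h Q.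
  by rewrite -[LHS](addKr (h P * - quo_lam P Q)) -p1; ring.
have g2 : gap Q = h Q * quo_lam P Q - h (P + Q) * h P.
  by rewrite -[LHS](addKr (h Q * - quo_lam P Q)) -p2; ring.
by rewrite /quo_y g1 g2; ring.
Qed.

(** If h(P) = 0, the chord relation gives y(P) = y(T). But y(T) = y(- T) = - y(T), so y(P) = 0,
    against [sys_y_neq0]. *)
Lemma quo_h_neq0 P : ~~ H (P + P) -> h P != 0.
Proof.
move=> hPP; have g := generic_T (notin_quo_double hPP).
apply: contraNneq (sys_y_neq0 S hPP) => hP0.
have := sys_chord S g; rewrite -/(h P) hP0 mulr0 => /esym/eqP.
rewrite subr_eq0 => /eqP ->.
have : y (- T) = y T.
  have -> : - T = T - (T + T) by rewrite opprD addrA subrr add0r.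
  by rewrite (sys_y S) // (subN H0 HB).
rewrite (sys_yN S) // => /eqP; rewrite eq_sym -subr_eq0 opprK -mulr2n -mulr_natl.
by rewrite mulf_eq0 (negPf two_neq0).
Qed.

(** If x(P) = x(P + T), the chord relations of P with P + T and with - (P + T) give y(P) = y(P + T)
    and y(P) = - y(P + T). *)
Lemma quo_gap_neq0 P : ~~ H' (P + P) -> gap P != 0.
Proof.
move=> /quo_notin [hPP hPPT]; have /quo_notin [hP hPT] := notin_quo_double hPP.
apply: contraNneq (sys_y_neq0 S hPP) => /eqP; rewrite subr_eq0 => /eqP xE.
have g1 : generic H P (P + T) by apply/and3P; rewrite addrA.
have g2 : generic H P (- (P + T)).
  by apply/and3P; rewrite opprD addrA subrr add0r -opprD !(subN H0 HB).
have := sys_chord S g1; have := sys_chord S g2.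
rewrite (sys_xN S) (sys_yN S) // xE subrr !mul0r opprK => e1 e2.
suff : 2 * y P == 0 by rewrite mulf_eq0 (negPf two_neq0).
have -> : 2 * y P = (y P - y (P + T)) + (y P + y (P + T)) by ring.
by rewrite -e1 -e2 addr0.
Qed.

Lemma quo_cocycle P Q R : generic H' P Q -> generic H' Q R -> ~~ H' R ->
  ~~ H' (P + Q + R) ->
  quo_lam P Q + quo_lam (P + Q) R = quo_lam Q R + quo_lam P (Q + R).
Proof.
move=> gPQ gQR nR nS; have [g1 _ _ _] := generic_quo gPQ.
have [g2 _ _ _] := generic_quo gQR.
have [nR' _] := quo_notin nR; have [nS' _] := quo_notin nS.
have := sys_cocycle S g1 g2 nR' nS'; rewrite /quo_lam [P + (Q + R)]addrA => e.
have -> : lam P Q = lam Q R + lam P (Q + R) - lam (P + Q) R by rewrite -e; ring.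
ring.
Qed.

Lemma quo_system : slope_system H' quo_x quo_y quo_lam quo_const.
Proof.
split.
- exact: quo_pred0.
- exact: quo_predB.
- move=> P A /orP [hA|hA].
    by rewrite /quo_x (addrAC P) !(sys_x S _ hA).
  have xA Q : x (Q + A) = x (Q + T) by rewrite -(subrK T A) addrA addrAC (sys_x S _ hA).
  by rewrite /quo_x (addrAC P) !xA -addrA (sys_x S _ HTT) addrC.
- move=> P A hA nP; have hAP : ~~ H' (P + A) by rewrite (subD quo_pred0 quo_predB).
  have base B R : H B -> ~~ H' R -> quo_y (R + B) = quo_y R.
    move=> hB nR.
    by rewrite /quo_y /quo_h /quo_gap (addrAC R) !(sys_x S _ hB) (sys_lam S hB (generic_T nR)).
  case/orP: hA => hA; first exact: base.
  have nP' : ~~ H' (P + (A - T)).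
    by rewrite (subD quo_pred0 quo_predB) // /quo_pred hA.
  rewrite -(subrK T A) addrA -(base _ P hA nP).
  move: (P + (A - T)) nP' => R nR.
  by rewrite /quo_y quo_hD // /quo_gap -addrA (sys_x S _ HTT); ring.
- by move=> P Q A; exact: quo_lam_inv.
- move=> P; rewrite /quo_x (sys_xN S) -[- P + T]opprK (sys_xN S) opprD opprK.
  by rewrite -[x (P - T)](sys_x S _ HTT) addrA subrK.
- move=> P nP; rewrite /quo_y quo_hN // /quo_gap (sys_xN S) -[- P + T]opprK (sys_xN S) opprD opprK.
  by rewrite -[x (P - T)](sys_x S _ HTT) addrA subrK mulNr.
- exact: quo_lamC.
- exact: quo_lam_opp.
- exact: quo_cocycle.
- exact: quo_square.
- exact: quo_chord.
- move=> P nPP; rewrite mulf_neq0 ?quo_gap_neq0 // quo_h_neq0 //.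
  by have [] := quo_notin nPP.
Qed.

Lemma lam_half z A : generic H' z (- A) ->
  2 * lam z (- A) = quo_lam z (- A) - h (z - A) + h z - h A.
Proof.
move=> g; have [nz nA nzA] := and3P g; rewrite (subN quo_pred0 quo_predB) in nA.
by rewrite /quo_lam quo_hN //; ring.
Qed.

Lemma lam_halfD z A : generic H' z (- A) ->
  2 * lam z (- (A + T)) = quo_lam z (- A) + h (z - A) + h z + h A.
Proof.
move=> g; have [nz nA nzA] := and3P g; rewrite (subN quo_pred0 quo_predB) in nA.
have g2 : generic H' z (- A + T) by rewrite genericC generic_quoDl genericC.
have [g2' _ _ _] := generic_quo g2.
have -> : - (A + T) = - A + T - (T + T) by rewrite !opprD addrA addrK.
rewrite (sys_lamr S) ?(subN H0 HB) // lam_shiftr // /quo_lam quo_hN //; ring.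
Qed.

(** This is [quo_product] for z and A - z, whose sum is A. The line through them also passes through
    - A, which turns their slope into [quo_lam z (- A)]. *)
Lemma quo_h_translate z A : h z != 0 -> generic H' z (- A) ->
  h (z - A) = - (h z)^-1 * (h A * quo_lam z (- A) + gap A).
Proof.
move=> hz0 g; have [nz nA nzA] := and3P g; have nA' := nA.
rewrite (subN quo_pred0 quo_predB) in nA'.
have gA : generic H' (- A) z by rewrite genericC.
have e1 := sys_lam_third quo_system gA; rewrite opprD opprK in e1.
have nAz : ~~ H' (A - z) by rewrite -opprB (subN quo_pred0 quo_predB).
have g2 : generic H' z (A - z) by apply/and3P; rewrite subrKC.
have := quo_product g2; rewrite e1 (quo_lamC gA) subrKC -[A - z]opprB quo_hN // => <-.
by rewrite mulrN mulrNN mulKf.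
Qed.

End Quotient.
End SlopeSystems.

(** * Divide and conquer *)

Section Recursion.
Variables (G : zmodType) (K : fieldType).
Hypothesis two_neq0 : (2 : K) != 0.

Lemma sum_halves (n : nat) (F : nat -> K) :
  \sum_(0 <= k < n + n) F k = \sum_(0 <= k < n) F k + \sum_(0 <= k < n) F (k + n)%N.
Proof.
rewrite (@big_cat_nat _ _ _ n) ?leq_addr //=; congr (_ + _).
by rewrite -{1}[n]add0n big_addn addnK.
Qed.

(* The value at z of the k-th element of the basis v, up to an additive
   constant. *)
Definition kernel (lam : G -> G -> K) (t z : G) (k : nat) : K :=
  if k == 0 then 1 else lam z (- (t *+ k)).

Lemma sys_mul (H : pred G) x y lam (cst : K) (S : slope_system H x y lam cst) P n :
  H P -> H (P *+ n).
Proof.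
move=> hP; elim: n => [|n IH]; first by rewrite mulr0n (sys0 S).
by rewrite mulrS (subD (sys0 S) (@sysB _ _ _ _ _ _ _ S)).
Qed.

(** * One folding step, from size 2N to size N *)

Section Folding.
Variables (H : pred G) (x y : G -> K) (lam : G -> G -> K) (cst : K).
Hypothesis S : slope_system H x y lam cst.
Variables (m : nat) (t : G).
Hypothesis ordT : forall k, H (t *+ k) = (2 ^ m.+1 %| k)%N.

Local Notation N := (2 ^ m)%N.
Local Notation T := (t *+ N).
Local Notation H' := (quo_pred H T).
Local Notation h := (quo_h lam T).
Local Notation gap := (quo_gap x T).
Local Notation lam' := (quo_lam lam T).

Let H0 := sys0 S.
Let HB := @sysB _ _ _ _ _ _ _ S.

Lemma notin_halfT : ~~ H T.
Proof.
rewrite ordT; apply/negP => /dvdn_leq; rewrite expn_gt0 /= => /(_ isT).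
by rewrite expnS mul2n -addnn leqNgt -[X in (X < _)%N]addn0 ltn_add2l expn_gt0.
Qed.

Lemma in_doubleT : H (T + T).
Proof. by rewrite -mulrnDr addnn -mul2n -expnS ordT. Qed.

Local Notation HT := notin_halfT.
Local Notation HTT := in_doubleT.

Lemma quo_ord k : H' (t *+ k) = (N %| k)%N.
Proof.
rewrite (quo_predE S HTT) -mulrnDr !ordT expnS.
have N0 : (0 < N)%N by rewrite expn_gt0.
apply/orP/idP => [[]|].
- exact: dvdn_trans (dvdn_mull _ (dvdnn _)).
- move/(dvdn_trans (dvdn_mull 2 (dvdnn N))).
  by rewrite dvdn_addl.
(* One of q and q + 1 is even, so one of k t and k t + T lies in H. *)
- case/dvdnP=> q ->; have -> : (q * N + N = q.+1 * N)%N by rewrite mulSn addnC.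
  rewrite !dvdn_pmul2r // !dvdn2 /=.
  by case: (odd q); [right|left].
Qed.

Lemma quo_notin_mul z : ~~ H (z *+ 2 ^ m.+1) -> ~~ H' (z *+ N).
Proof.
rewrite expnS mul2n -addnn mulrnDr; exact: (notin_quo_double S HTT).
Qed.

Lemma quo_sys : slope_system H' (quo_x x T) (quo_y x lam T) lam' (quo_const x cst T).
Proof. exact: (quo_system S two_neq0 HT HTT). Qed.

Lemma notin_quo z : ~~ H (z *+ 2 ^ m.+1) -> ~~ H' z.
Proof. by move/quo_notin_mul; apply: contra => hz; exact: (sys_mul quo_sys). Qed.

Lemma notin_translate z k : ~~ H (z *+ 2 ^ m.+1) ->
  ~~ H ((z - t *+ k) *+ 2 ^ m.+1).
Proof.
by rewrite mulrnBl -mulrnA (subD H0 HB) // (subN H0 HB) // ordT dvdn_mull.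
Qed.

Lemma notin_shift z k : ~~ H (z *+ 2 ^ m.+1) ->
  ~~ H ((z + t *+ k) *+ 2 ^ m.+1).
Proof. by rewrite mulrnDl -mulrnA (subD H0 HB) // ordT dvdn_mull. Qed.

Lemma h_neq0 z : ~~ H (z *+ 2 ^ m.+1) -> h z != 0.
Proof.
move=> hz; apply: (quo_h_neq0 S two_neq0 HT HTT) => //.
rewrite -mulr2n; apply: contra hz => hz.
by rewrite expnS mulrnA (sys_mul S).
Qed.

Section FoldStep.
Variables (c : nat -> K).

Definition fold_even (k : nat) : K := 2^-1 * c (k + N)%N + 2^-1 * c k.
Definition fold_odd (k : nat) : K := 2^-1 * c (k + N)%N + - 2^-1 * c k.
(** Coefficient of h(z) in the odd part. The factors 1 give the literal shape of the values produced
    by [reach_lin2] and [reach_sum]. *)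
Definition fold_slope : K := 1 * c N + 1 * \sum_(1 <= k < N) 1 * fold_even k.
(** Index 0 belongs to the constant function, so it collects the constants h(k t) left over when the
    terms k and k + N are combined. *)
Definition fold_plus (k : nat) : K :=
  if k == 0 then 1 * c 0%N + 1 * \sum_(1 <= i < N) h (t *+ i) * fold_odd i
  else fold_even k.
Definition fold_minus (k : nat) : K :=
  if k == 0 then \sum_(1 <= i < N) gap (t *+ i) * fold_odd i
  else h (t *+ k) * fold_odd k.

(* The parts of the combination that are even and odd under translation by T. *)
Definition fold_A (z : G) : K := \sum_(0 <= k < N) fold_plus k * kernel lam' t z k.
Definition fold_B (z : G) : K := h z * fold_slope
  + - (h z)^-1 * \sum_(0 <= k < N) fold_minus k * kernel lam' t z k.

Lemma generic_kernel z k : ~~ H (z *+ 2 ^ m.+1) -> (0 < k < N)%N ->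
  generic H' z (- (t *+ k)).
Proof.
move=> hz /andP [k0 kN].
apply/and3P; split; first exact: notin_quo; last exact/notin_quo/notin_translate.
rewrite (subN (sys0 quo_sys) (sysB quo_sys)) quo_ord; apply/negP => /dvdn_leq.
by rewrite k0 leqNgt kN => /(_ isT).
Qed.

Lemma fold_evalE z : ~~ H (z *+ 2 ^ m.+1) ->
  \sum_(0 <= k < 2 ^ m.+1) c k * kernel lam t z k = 1 * fold_A z + 1 * fold_B z.
Proof.
move=> hz; have N0 : (0 < N)%N by rewrite expn_gt0.
have hz0 := h_neq0 hz; have gT := generic_T S HT HTT (notin_quo hz).
have -> : (2 ^ m.+1 = N + N)%N by rewrite expnS mul2n -addnn.
rewrite sum_halves.
rewrite /fold_A /fold_B /fold_slope.
(* Index N, paired with the constant function of index 0, contributes h(z) itself because - T and T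
   agree modulo H. *)
rewrite !(big_ltn N0) add0n; have kerN : kernel lam t z N = h z.
  by rewrite /kernel eqn0Ngt N0 /= (quo_lam_oppT S HTT gT).
have ker0 l : kernel l t z 0 = 1 by [].
rewrite kerN !ker0.
set L := fun k => lam' z (- (t *+ k)).
(* Terms k and k + N are combined by [lam_half] and [lam_halfD]; the remaining h(z - k t) is
   eliminated by [quo_h_translate]. *)
have termE k : (1 <= k < N)%N ->
    c k * kernel lam t z k + c (k + N)%N * kernel lam t z (k + N)
    = fold_even k * L k + fold_even k * h z + h (t *+ k) * fold_odd k
      + - (h z)^-1 * (gap (t *+ k) * fold_odd k)
      + - (h z)^-1 * (h (t *+ k) * fold_odd k * L k).
  move=> hk; have g := generic_kernel hz hk; case/andP: hk => k0 _.
  rewrite /kernel addn_eq0 eqn0Ngt k0 /=.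
  have e1 := lam_half S HT HTT g; have e2 := lam_halfD S HT HTT g.
  have e3 := quo_h_translate S two_neq0 HT HTT hz0 g.
  apply: (mulfI two_neq0); rewrite mulrDr !(mulrCA 2) e1 mulrnDr e2 e3 /L.
  rewrite /fold_even /fold_odd.
  move: (lam' z _) (h z) (h (t *+ k)) (gap _) (c _) (c _) hz0 => l h1 h2 ga c1 c2 h10.
  by field; rewrite two_neq0 h10.
have sum1 : \sum_(1 <= k < N) (c k * kernel lam t z k)
   + \sum_(1 <= k < N) c (k + N)%N * kernel lam t z (k + N)
   = \sum_(1 <= k < N) fold_even k * L k
     + (\sum_(1 <= k < N) fold_even k) * h z
     + \sum_(1 <= k < N) h (t *+ k) * fold_odd k
     + - (h z)^-1 * \sum_(1 <= k < N) gap (t *+ k) * fold_odd k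
     + - (h z)^-1 * \sum_(1 <= k < N) h (t *+ k) * fold_odd k * L k.
  by rewrite mulr_suml !mulr_sumr -!big_split; apply: eq_big_nat termE.
have sum2 : \sum_(1 <= k < N) fold_plus k * kernel lam' t z k
    = \sum_(1 <= k < N) fold_even k * L k.
  by apply: eq_big_nat => k /andP [k0 _]; rewrite /fold_plus /kernel eqn0Ngt k0.
have sum3 : \sum_(1 <= k < N) fold_minus k * kernel lam' t z k
    = \sum_(1 <= k < N) h (t *+ k) * fold_odd k * L k.
  by apply: eq_big_nat => k /andP [k0 _]; rewrite /fold_minus /kernel eqn0Ngt k0.
have sum4 : \sum_(1 <= k < N) 1 * fold_even k = \sum_(1 <= k < N) fold_even k.
  by apply: eq_bigr => k _; rewrite mul1r.
rewrite sum2 sum3 sum4 /fold_plus /fold_minus !eqxx addrACA sum1; ring.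
Qed.

(** The slopes [lam'] are invariant under T and h changes sign, so translation by T fixes [fold_A]
    and negates [fold_B]. *)
Lemma fold_evalD z : ~~ H (z *+ 2 ^ m.+1) ->
  \sum_(0 <= k < 2 ^ m.+1) c k * kernel lam t (z + T) k = 1 * fold_A z + -1 * fold_B z.
Proof.
move=> hz; rewrite fold_evalE ?notin_shift // /fold_B.
have -> : h (z + T) = - h z by exact: (quo_hD S HT HTT (notin_quo hz)).
have eqk k : (0 <= k < N)%N -> kernel lam' t (z + T) k = kernel lam' t z k.
  case: k => [//|k] hk; have g : generic H' z (- (t *+ k.+1)) by exact: generic_kernel.
  by have := quo_lamDT S HT HTT g.
have -> : fold_A (z + T) = fold_A z.
  by apply: eq_big_nat => k /eqk ->.
rewrite (eq_big_nat _ _ (F2 := fun k => fold_minus k * kernel lam' t z k)).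
  by rewrite invrN; ring.
by move=> k /eqk ->.
Qed.

End FoldStep.

End Folding.
(** The coefficients are arbitrary values already available after s, so that the recursive calls can
    be chained. With N half of the size, a step costs at most 22 N + 6 operations besides its two
    calls, and 22 N + 6 <= 28 N = 14 * (2 N). *)
Theorem slope_eval (n m : nat) (H : pred G) x y lam (cst : K)
    (S : slope_system H x y lam cst) (t b : G) (c : nat -> seq K -> K)
    (s : seq (operation K)) :
  (forall k, H (t *+ k) = (2 ^ m %| k)%N) -> ~~ H (b *+ 2 ^ m) ->
  body_ok n s -> (forall k, (k < 2 ^ m)%N -> avail n s (c k)) ->
  exists2 s', reach n (14 * m * 2 ^ m) s s' &
    forall l, (l < 2 ^ m)%N -> avail n s'
      (fun inp => \sum_(0 <= k < 2 ^ m) c k inp * kernel lam t (b + t *+ l) k).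
Proof.
elim: m H x y lam cst S t b c s => [|m IH] H x y lam cst S t b c s ordT hb hs hc.
  exists s; first by rewrite muln0; exact: reach0.
  move=> l _; apply: avail_ext (hc 0%N isT) => inp.
  by rewrite big_nat1 /kernel eqxx mulr1.
set N := (2 ^ m)%N; set T := t *+ N.
have N0 : (0 < N)%N by rewrite expn_gt0.
have NN : (2 ^ m.+1 = N + N)%N by rewrite expnS mul2n -addnn.
have S' := quo_sys S ordT.
pose ci inp k := c k inp.
pose ev k inp := fold_even m (ci inp) k.
pose od k inp := fold_odd m (ci inp) k.
pose pl k inp := fold_plus lam m t (ci inp) k.
pose mi k inp := fold_minus x lam m t (ci inp) k.
have [s1 r1 A1] : exists2 s', reach n (N * 3) s s' &
    forall k, (k < N)%N -> avail n s' (ev k).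
  apply: reach_family => // u q k ru hk.
  by apply: reach_lin2; [exact: reach_ok ru|apply: (avail_reach ru); apply: hc..]; lia.
have [s2 r2 A2] : exists2 s', reach n (N * 3) s1 s' &
    forall k, (k < N)%N -> avail n s' (od k).
  apply: reach_family (reach_ok r1) _ => u q k ru hk.
  by apply: reach_lin2; [exact: reach_ok ru|
    apply: (avail_reach ru); apply: (avail_reach r1); apply: hc..]; lia.
have size_N : (size (index_iota 1 N) <= N)%N by rewrite size_iota leq_subr.
have mem_N i : i \in index_iota 1 N -> (i < N)%N by rewrite mem_index_iota => /andP [].
have [|s3 r3 A3] := reach_sum (I := index_iota 1 N) (f := od)
    (fun i => quo_h lam T (t *+ i)) (reach_ok r2).
  by move=> i /mem_N; exact: A2.
have [|s4 r4 A4] := reach_sum (I := index_iota 1 N) (f := od)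
    (fun i => quo_gap x T (t *+ i)) (reach_ok r3).
  by move=> i /mem_N hi; apply: (avail_reach r3); exact: A2.
have r24 := reach_trans r2 (reach_trans r3 r4).
have [|s5 r5 A5] := reach_sum (I := index_iota 1 N) (f := ev)
    (fun i => 1) (reach_ok r4).
  by move=> i /mem_N hi; apply: (avail_reach r24); exact: A1.
have r15 := reach_trans r1 (reach_trans r24 r5).
have r35 := reach_trans r4 r5.
have [s6 r6 A6] : exists2 s', reach n 3 s5 s' & avail n s' (pl 0%N).
  apply: reach_lin2 (reach_ok r5) (avail_reach r15 _) (avail_reach r35 A3).
  by apply: hc; lia.
have [s7 r7 A7] : exists2 s', reach n 3 s6 s' &
    avail n s' (fun inp => fold_slope m (ci inp)).
  apply: reach_lin2 (reach_ok r6) (avail_reach r6 (avail_reach r15 _)) (avail_reach r6 A5).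
  by apply: hc; lia.
have [s8 r8 A8] : exists2 s', reach n (N * 1) s7 s' &
    forall k, (k < N)%N -> avail n s' (mi k).
  apply: reach_family (reach_ok r7) _ => u q k ru hk.
  have r7u := reach_trans r7 ru.
  case: k hk => [|k] hk.
    exists u; first by apply: reachW (reach0 (reach_ok ru)).
    by apply: (avail_reach (reach_trans r5 (reach_trans r6 r7u))).
  apply: reach_scale (reach_ok ru) _.
  apply: (avail_reach (reach_trans r35 (reach_trans r6 r7u))).
  by apply: (avail_reach r3); apply: A2.
have r68 := reach_trans r6 (reach_trans r7 r8).
have hb' : ~~ quo_pred H T (b *+ N) by exact: (quo_notin_mul S ordT).
have hb_l l : ~~ H ((b + t *+ l) *+ 2 ^ m.+1) by exact: (notin_shift S ordT).
have [|s9 r9 A9] := IH _ _ _ _ _ S' t b pl s8 (quo_ord S ordT) hb' (reach_ok r8).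
  case=> [|k] hk; first by apply: (avail_reach (reach_trans r7 r8)).
  by apply: (avail_reach (reach_trans r24 (reach_trans r5 r68))); apply: A1.
have [|s10 r10 A10] := IH _ _ _ _ _ S' t b mi s9 (quo_ord S ordT) hb' (reach_ok r9).
  by move=> k hk; apply: (avail_reach r9); exact: A8.
have [s11 r11 A11] : exists2 s', reach n (N * 3) s10 s' & forall l, (l < N)%N ->
    avail n s' (fun inp => fold_B x lam m t (ci inp) (b + t *+ l)).
  apply: reach_family (reach_ok r10) _ => u q l ru hl.
  have r8u := reach_trans (reach_trans r8 (reach_trans r9 r10)) ru.
  apply: reach_lin2 (reach_ok ru) (avail_reach r8u A7) (avail_reach ru _).
  exact: A10.
have [s12 r12 A12] : exists2 s', reach n (2 ^ m.+1 * 3) s11 s' &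
    forall l, (l < 2 ^ m.+1)%N -> avail n s' (fun inp =>
      \sum_(0 <= k < 2 ^ m.+1) c k inp * kernel lam t (b + t *+ l) k).
  apply: reach_family (reach_ok r11) _ => u q l ru hl.
  have rA := reach_trans (reach_trans r10 r11) ru.
  have [lt_lN|le_Nl] := ltnP l N.
    have [v w W] := reach_lin2 1 1 (reach_ok ru) (avail_reach rA (A9 _ lt_lN))
      (avail_reach ru (A11 _ lt_lN)).
    exists v => //; apply: avail_ext W => inp.
    by have := fold_evalE S ordT (ci inp) (hb_l l).
  (* Here b + l t is the translate by T of b + (l - N) t, where both parts are already known; the
     odd one is subtracted. *)
  have lt_lN : (l - N < N)%N by rewrite ltn_subLR // -NN.
  have [v w W] := reach_lin2 1 (-1) (reach_ok ru) (avail_reach rA (A9 _ lt_lN))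
    (avail_reach ru (A11 _ lt_lN)).
  exists v => //; apply: avail_ext W => inp.
  rewrite -[l in RHS](subnK le_Nl) mulrnDr addrA.
  by have := fold_evalD S ordT (ci inp) (hb_l (l - N)%N).
exists s12 => //.
have R := reach_trans (reach_trans r15 r68)
  (reach_trans r9 (reach_trans r10 (reach_trans r11 r12))).
apply: reachW R; rewrite NN -/N.
move: (size (index_iota 1 N)) size_N N0 => q; clear -q; lia.
Qed.

End Recursion.

(** * Values of functions *)

Section LocalValues.
Variables (K : fieldType) (E : weierstrass K) (L : fieldType).
Variables (g : {rmorphism {poly K} -> L}) (Y : L).
Hypothesis model : coord_model E g Y.
Variables (x y : K).
Hypothesis xyE : on_curve E (Some (x, y)).

Local Notation X := (g 'X).
Local Notation c := (fun k => g k%:P).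

(** An affine counterpart of [has_value], with quotients of elements of the coordinate ring instead
    of forms; it is easily propagated through field operations. *)
Definition local_value (f : L) (v : K) : Prop :=
  exists a s va vs, [/\ value_at g Y x y a va, value_at g Y x y s vs, vs != 0,
    f * s = a & v = va / vs].

Lemma local_of_value f v : value_at g Y x y f v -> local_value f v.
Proof.
move=> h; exists f, 1, v, 1; rewrite mulr1 divr1 oner_neq0; split=> //.
by rewrite -(rmorph1 g) -(hornerC 1 x); exact: value_at_poly.
Qed.

Lemma local_poly p : local_value (g p) p.[x].
Proof. exact/local_of_value/value_at_poly. Qed.

Lemma local_const k : local_value (c k) k.
Proof. by have := local_poly k%:P; rewrite hornerC. Qed.

Lemma local_x : local_value X x.
Proof. by have := local_poly 'X; rewrite hornerX. Qed.

Lemma local_y : local_value Y y.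
Proof. exact/local_of_value/value_at_y. Qed.

Lemma localD f f' v v' :
  local_value f v -> local_value f' v' -> local_value (f + f') (v + v').
Proof.
move=> [a [s [va [vs [ha hs s0 fs ->]]]]] [a' [s' [va' [vs' [ha' hs' s0' fs' ->]]]]].
subst a a'.
exists (f * s * s' + f' * s' * s), (s * s'), (va * vs' + va' * vs), (vs * vs'); split.
- by apply: value_atD; apply: (value_atM model).
- exact: (value_atM model).
- by rewrite mulf_neq0.
- ring.
- by field; rewrite s0 s0'.
Qed.

Lemma localM f f' v v' :
  local_value f v -> local_value f' v' -> local_value (f * f') (v * v').
Proof.
move=> [a [s [va [vs [ha hs s0 fs ->]]]]] [a' [s' [va' [vs' [ha' hs' s0' fs' ->]]]]].
subst a a'.
exists (f * s * (f' * s')), (s * s'), (va * va'), (vs * vs'); split.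
- exact: (value_atM model).
- exact: (value_atM model).
- by rewrite mulf_neq0.
- ring.
- by field; rewrite s0 s0'.
Qed.

Lemma localN f v : local_value f v -> local_value (- f) (- v).
Proof.
move=> [a [s [va [vs [ha hs s0 fs ->]]]]]; subst a.
exists (- (f * s)), s, (- va), vs; split=> //; rewrite ?mulNr //.
exact: value_atN.
Qed.

Lemma localB f f' v v' :
  local_value f v -> local_value f' v' -> local_value (f - f') (v - v').
Proof. by move=> h h'; apply/localD/localN. Qed.

Lemma local_neq0 f v : local_value f v -> v != 0 -> f != 0.
Proof.
move=> [a [s [va [vs [ha hs s0 fs ->]]]]]; apply: contraNneq => f0.
have h0 : value_at g Y x y 0 0.
  by have := value_at_poly g Y x y 0; rewrite rmorph0 horner0.
move: ha; rewrite -fs f0 mul0r => /(value_at_fun model h0) <-.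
by rewrite mul0r.
Qed.

Lemma localV f v : local_value f v -> v != 0 -> local_value f^-1 v^-1.
Proof.
move=> h v0; have f0 := local_neq0 h v0.
move: h v0 => [a [s [va [vs [ha hs s0 fs ->]]]]]; rewrite mulf_eq0 negb_or => /andP [va0 _].
exists s, a, vs, va; split=> //; first by rewrite -fs mulKf.
by rewrite invf_div.
Qed.

Lemma local_div f f' v v' : local_value f v -> local_value f' v' -> v' != 0 ->
  local_value (f / f') (v / v').
Proof. by move=> h h' v0; apply/localM => //; exact: localV. Qed.

Lemma local_sum (I : Type) (r : seq I) (F : I -> L) (V : I -> K) :
  (forall i, local_value (F i) (V i)) ->
  local_value (\sum_(i <- r) F i) (\sum_(i <- r) V i).
Proof.
move=> h; elim: r => [|i r IH]; last by rewrite !big_cons; exact: localD.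
by rewrite !big_nil -(rmorph0 g); exact: (local_const 0).
Qed.

Definition generic_diff (A : point K) : point L :=
  psub (map_curve c E) (Some (X, Y)) (map_point c A).

(** As A is neither (x, y) nor its opposite, their abscissas differ. The same chord formula then
    computes both differences, with a denominator that does not vanish at (x, y). *)
Lemma local_generic_diff A : A <> Some (x, y) -> A <> popp E (Some (x, y)) ->
  on_curve E A ->
  local_value (xcoord (generic_diff A)) (xcoord (psub E (Some (x, y)) A)) /\
  local_value (ycoord (generic_diff A)) (ycoord (psub E (Some (x, y)) A)).
Proof.
case: A => [[x0 y0]|] nA nA' AE; last by split; [exact: local_x|exact: local_y].
have x0x : x0 != x.
  apply/eqP => ex; rewrite ex in nA nA' AE.
  have np : Some (x, y0) != popp E (Some (x, y)) by apply/eqP.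
  by apply: nA; rewrite (eq_x_on_curve xyE AE np).
have Xx0 : X - c x0 != 0 := XsubC_neq0 model x0.
have X0 : (X == c x0) = false by rewrite -subr_eq0 (negPf Xx0).
have xx0 : (x == x0) = false by rewrite eq_sym (negPf x0x).
set B := - y0 - a1 E * x0 - a3 E.
pose l := (B - y) / (x0 - x).
pose Bg : L := - c y0 - c (a1 E) * c x0 - c (a3 E).
pose lg := (Bg - Y) / (c x0 - X).
have hB : local_value Bg B.
  by do ?apply: localB; try exact: local_const; [apply: localN; exact: local_const|
    apply: localM; exact: local_const].
have hl : local_value lg l.
  apply: local_div; [by apply: localB => //; exact: local_y| |by rewrite subr_eq0].
  by apply: localB; [exact: local_const|exact: local_x].
have np : (Some (x0, B) == popp E (Some (x, y))) = false.
  by rewrite /popp; apply/eqP => -[ex _]; rewrite ex eqxx in x0x.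
have npg : (Some (c x0, Bg) == popp (map_curve c E) (Some (X, Y))) = false.
  by rewrite /popp; apply/eqP => -[ex _]; rewrite ex eqxx in X0.
have hx : local_value (lg ^+ 2 + c (a1 E) * lg - c (a2 E) - X - c x0)
    (l ^+ 2 + a1 E * l - a2 E - x - x0).
  do 3!(apply: localB; [|first [exact: local_const | exact: local_x]]).
  by apply: localD; apply: localM => //; exact: local_const.
have hy : local_value
  (lg * (X - (lg ^+ 2 + c (a1 E) * lg - c (a2 E) - X - c x0)) - Y
    - c (a1 E) * (lg ^+ 2 + c (a1 E) * lg - c (a2 E) - X - c x0) - c (a3 E))
  (l * (x - (l ^+ 2 + a1 E * l - a2 E - x - x0)) - y
    - a1 E * (l ^+ 2 + a1 E * l - a2 E - x - x0) - a3 E).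
  apply: localB; last exact: local_const.
  apply: localB; last by apply: localM => //; exact: local_const.
  apply: localB; last exact: local_y.
  by apply: localM => //; apply: localB => //; exact: local_x.
rewrite /generic_diff /psub /map_point /= -/Bg -/B.
rewrite /padd npg np X0 xx0 /= -/lg -/l; split=> //.
Qed.

End LocalValues.

Section Forms.
Variables (K : fieldType) (p q : {poly K}).

(** Coefficients of the form that dehomogenizes to p(x) + q(x) y. *)
Definition linear_form (i j : nat) : K :=
  if j == 0%N then p`_i else if j == 1%N then q`_i else 0.

Lemma form_eval_linear (F : fieldType) (phi : K -> F) (n : nat) (x y : F) :
  phi 0 = 0 -> (0 < n)%N -> (size q <= n)%N ->
  form_eval phi n linear_form (Some (x, y))
  = \sum_(i < n.+1) phi p`_i * x ^+ i + (\sum_(i < n.+1) phi q`_i * x ^+ i) * y.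
Proof.
move=> phi0 n0 size_q; rewrite /form_eval /= mulr_suml -big_split /=.
apply: eq_bigr => i _; rewrite big_mkcond big_ord_recl /= addn0 -ltnS ltn_ord.
case: n n0 size_q i => [//|n] _ size_q i; rewrite big_ord_recl /= big1 => [|j _].
  rewrite addr0 /linear_form /= expr0 expr1 !expr1n !mulr1; congr (_ + _).
  (* The monomial X^n Y exceeds the degree n, but its coefficient is zero by the bound on the size
     of q. *)
  have [_ //|le_ni] := leqP.
  rewrite nth_default ?phi0 ?mul0r //; apply: leq_trans size_q _.
  by rewrite /bump leq0n addn1 in le_ni; lia.
by rewrite /linear_form /= phi0 !mul0r if_same.
Qed.

End Forms.

Section FunctionFieldValues.
Variables (K : fieldType) (E : weierstrass K).

Lemma fpoly_sum (p : {poly K}) n : (size p <= n)%N ->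
  fpoly E p = \sum_(i < n) fconst E p`_i * fx E ^+ i.
Proof.
move=> sz; rewrite -{1}(take_poly_id sz) /take_poly poly_def rmorph_sum /=.
by apply: eq_bigr => i _; rewrite -mul_polyC rmorphM rmorphXn.
Qed.

Lemma has_value_of_local (x y : K) f v :
  local_value (fpoly E) (fy E) x y f v -> has_value idfun (Some (x, y)) f v.
Proof.
case=> a [s [va [vs [[p [q [-> ->]]] [p' [q' [-> ->]]] s0 fs ->]]]].
(* A common degree large enough to homogenize both numerator and denominator. *)
pose n := (size p + size q + size p' + size q').+1.
have sums (r : {poly K}) : (size r <= n.+1)%N ->
    (\sum_(i < n.+1) r`_i * x ^+ i = r.[x])
    * (\sum_(i < n.+1) fconst E r`_i * fx E ^+ i = fpoly E r).
  by move=> hr; rewrite (horner_coef_wide _ hr) (fpoly_sum hr).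
have f0 : fconst E 0 = 0 by rewrite rmorph0.
have sz : [/\ (size p <= n.+1)%N, (size q <= n)%N, (size p' <= n.+1)%N & (size q' <= n)%N].
  by rewrite /n; split; lia.
case: sz => sp sq sp' sq'.
exists n, (linear_form p q), (linear_form p' q').
have n0 : (0 < n)%N by [].
have [xp yp] := sums _ sp; have [xq yq] := sums _ (leqW sq).
have [xp' yp'] := sums _ sp'; have [xq' yq'] := sums _ (leqW sq').
have v0 : idfun (0 : K) = 0 by [].
have F1 := form_eval_linear p x y v0 n0 sq.
have F2 := form_eval_linear p' x y v0 n0 sq'.
have G1 := form_eval_linear p (fx E) (fy E) f0 n0 sq.
have G2 := form_eval_linear p' (fx E) (fy E) f0 n0 sq'.
have {}F1 := etrans F1 (f_equal2 (fun a b => a + b * y) xp xq).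
have {}F2 := etrans F2 (f_equal2 (fun a b => a + b * y) xp' xq').
have {}G1 := etrans G1 (f_equal2 (fun a b => a + b * fy E) yp yq).
have {}G2 := etrans G2 (f_equal2 (fun a b => a + b * fy E) yp' yq').
split.
- by rewrite F2.
- exact: etrans (congr1 (fun a => f * a) G2) (etrans fs (esym G1)).
- by rewrite F1 F2.
Qed.

End FunctionFieldValues.

(** * The group of points *)

Section GroupOfPoints.
Variables (K : fieldType) (E : weierstrass K).

(** Nonsingularity is a parameter of the type because the group structure attached to it relies on
    it for associativity. *)
Definition epoint (disc0 : discriminant E != 0) : Type :=
  {P : point K | on_curve E P}.

Variable disc0 : discriminant E != 0.
Local Notation EP := (epoint disc0).

HB.instance Definition _ := Choice.copy EP {P : point K | on_curve E P}.

Definition epoint0 : EP := exist _ None isT.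
Definition eopp (P : EP) : EP :=
  exist _ (popp E (val P)) (etrans (on_curve_popp E (val P)) (valP P)).
Definition eadd (P Q : EP) : EP :=
  exist _ (padd E (val P) (val Q)) (on_curve_padd (valP P) (valP Q)).

Lemma eaddA : associative eadd.
Proof.
move=> P Q R; apply: val_inj.
exact: (paddA (funfield_model E) disc0 (valP P) (valP Q) (valP R)).
Qed.

Lemma eaddC : commutative eadd.
Proof.
move=> P Q; apply: val_inj.
exact: (paddC (funfield_model E) disc0 (valP P) (valP Q)).
Qed.

Lemma eadd0 : left_id epoint0 eadd.
Proof. by move=> P; apply: val_inj. Qed.

Lemma eaddN : left_inverse epoint0 eopp eadd.
Proof. by move=> P; rewrite eaddC; apply: val_inj; rewrite /= paddN. Qed.

HB.instance Definition _ := GRing.isZmodule.Build EP eaddA eaddC eadd0 eaddN.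

Lemma val_epointD (P Q : EP) : val (P + Q) = padd E (val P) (val Q).
Proof. by []. Qed.

Lemma val_epointN (P : EP) : val (- P) = popp E (val P).
Proof. by []. Qed.

Lemma val_epoint_eq0 (P : EP) : (val P == None) = (P == 0).
Proof. by rewrite -(inj_eq val_inj). Qed.

Lemma val_epointMn (P : EP) n : val (P *+ n) = pmul E n (val P).
Proof.
elim: n => [|n IH] //; rewrite mulrS val_epointD IH; by [].
Qed.

Lemma epoint_neq0 (P : EP) : P != 0 -> exists x y, val P = Some (x, y).
Proof. by rewrite -val_epoint_eq0; case: (val P) => [[x y]|] // _; exists x, y. Qed.

Definition ept_x (P : EP) : K := xcoord (val P).
(** The ordinate after completing the square in y, which makes it odd; the slope and the constant
    below are shifted accordingly. *)
Definition ept_y (P : EP) : K :=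
  if val P is Some (x, y) then y + 2^-1 * (a1 E * x + a3 E) else 0.
Definition ept_slope (P Q : EP) : K := slope E (val P) (val Q) + 2^-1 * a1 E.
Definition ept_const : K := a2 E + (2^-1 * a1 E) ^+ 2.

Hypothesis two_neq0 : (2 : K) != 0.

Lemma ept_neq_opp (P Q : EP) : P + Q != 0 -> val Q != popp E (val P).
Proof.
by apply: contraNneq => QE; rewrite -val_epoint_eq0 val_epointD QE paddN.
Qed.

Lemma generic0P (P Q : EP) : generic (pred1 0) P Q -> exists x1 y1 x2 y2,
  [/\ val P = Some (x1, y1), val Q = Some (x2, y2),
      on_curve E (Some (x1, y1)), on_curve E (Some (x2, y2)) &
      Some (x2, y2) != popp E (Some (x1, y1))].
Proof.
case/and3P=> /= P0 Q0 PQ0; have [x1 [y1 PE]] := epoint_neq0 P0.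
have [x2 [y2 QE]] := epoint_neq0 Q0; exists x1, y1, x2, y2.
have c1 : on_curve E (Some (x1, y1)) by rewrite -PE; exact: (valP P).
have c2 : on_curve E (Some (x2, y2)) by rewrite -QE; exact: (valP Q).
by split=> //; have := ept_neq_opp PQ0; rewrite PE QE.
Qed.

Lemma ept_system : slope_system (pred1 (0 : EP)) ept_x ept_y ept_slope ept_const.
Proof.
have nz (P : EP) : P != 0 -> val P <> None.
  by rewrite -val_epoint_eq0 => /eqP.
split=> /=.
- exact: eqxx.
- by move=> P Q /eqP -> /eqP ->; rewrite subr0.
- by move=> P A /eqP ->; rewrite addr0.
- by move=> P A /eqP ->; rewrite addr0.
- by move=> P Q A /eqP ->; rewrite addr0.
- by move=> P; rewrite /ept_x val_epointN; case: (val P) => [[]|].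
- move=> P P0; have [x [y PE]] := epoint_neq0 P0.
  by rewrite /ept_y val_epointN PE /=; field.
- move=> P Q /generic0P [x1 [y1 [x2 [y2 [PE QE c1 c2 npp]]]]].
  rewrite /ept_slope PE QE; congr (_ + _); rewrite /slope.
  have [x12|x12] := eqVneq x1 x2.
    by rewrite -x12 in c2 npp *; rewrite (eq_x_on_curve c1 c2 npp).
  by rewrite -[y2 - y1]opprB -[x2 - x1]opprB invrN mulrNN.
- move=> P Q /and3P [/= /nz P0 /nz Q0 /nz PQ0].
  rewrite /ept_slope val_epointD val_epointN.
  rewrite (slope_oppr (funfield_model E) disc0 (valP P) (valP Q) P0 Q0 PQ0).
  by field.
- move=> P Q R /and3P [/= /nz P0 /nz Q0 /nz PQ0] /and3P [_ /= /nz R0 /nz QR0] _ /nz PQR0.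
  rewrite /ept_slope !val_epointD addrACA.
  rewrite (slope_cocycle (funfield_model E) disc0 (valP P) (valP Q) (valP R)) //.
  by rewrite addrACA.
- move=> P Q /generic0P [x1 [y1 [x2 [y2 [PE QE c1 c2 npp]]]]].
  rewrite /ept_slope /ept_x val_epointD PE QE padd_slope //.
  by move: (slope E _ _) => l; rewrite /= /ept_const; field.
- move=> P Q /generic0P [x1 [y1 [x2 [y2 [PE QE c1 c2 npp]]]]].
  rewrite /ept_slope /ept_x /ept_y PE QE /=.
  have [x12|x12] := eqVneq x1 x2.
    by rewrite -x12 in c2 npp *; rewrite (eq_x_on_curve c1 c2 npp); ring.
  by field; rewrite two_neq0 subr_eq0 eq_sym x12.
- move=> P PP0; have P0 : P != 0 by apply: contraNneq PP0 => ->; rewrite addr0.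
  have [x [y PE]] := epoint_neq0 P0; have := ept_neq_opp PP0.
  rewrite PE => /y_neq_popp; rewrite /ept_y PE; apply: contraNneq => y0.
  by rewrite -[X in _ == X](mulr0 2) -y0; apply/eqP; field.
Qed.

(** At z, the function u_(A,B) is the slope of the chord through z - A and A - B. The hypotheses
    keep these two points affine with distinct abscissas. *)
Lemma local_u (A B z : EP) (x y : K) : val z = Some (x, y) ->
  z - A != 0 -> z + A != 0 -> A - B != 0 -> z - A - (A - B) != 0 -> z - B != 0 ->
  local_value (fpoly E) (fy E) x y (u_ E (val A) (val B))
    (ept_slope (z - A) (A - B) - 2^-1 * a1 E).
Proof.
move=> zE zA0 zA0' AB0 n1 n2; have zc : on_curve E (Some (x, y)) by rewrite -zE (valP z).
have nA : val A <> Some (x, y).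
  by rewrite -zE => /val_inj Az; rewrite Az subrr eqxx in zA0.
have nA' : val A <> popp E (Some (x, y)).
  by rewrite -zE -val_epointN => /val_inj Az; rewrite Az subrr eqxx in zA0'.
have [hx hy] := local_generic_diff (funfield_model E) zc nA nA' (valP A).
have g : generic (pred1 0) (z - A) (A - B).
  by apply/and3P; split=> //=; rewrite addrA subrK.
have [x1 [y1 [x2 [y2 [PE QE c1 c2 npp]]]]] := generic0P g.
have x12 : x1 != x2.
  apply/eqP => x12; rewrite -x12 in c2 npp QE.
  have y12 := eq_x_on_curve c1 c2 npp.
  by move: n1; rewrite subr_eq0 -(inj_eq val_inj) PE QE y12 eqxx.
have -> : ept_slope (z - A) (A - B) - 2^-1 * a1 E = (y1 - y2) / (x1 - x2).
  rewrite /ept_slope addrK PE QE /slope (negPf x12).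
  by rewrite -[y2 - y1]opprB -[x2 - x1]opprB invrN mulrNN.
have ABE : psub E (val A) (val B) = Some (x2, y2) := QE.
have zAE : psub E (Some (x, y)) (val A) = Some (x1, y1) by rewrite -zE; exact: PE.
rewrite zAE /= in hx hy; rewrite /u_ ABE /=.
apply: (local_div (funfield_model E) zc); last by rewrite subr_eq0.
  by apply: (localB (funfield_model E) zc hy); exact: local_const.
by apply: (localB (funfield_model E) zc hx); exact: local_const.
Qed.

End GroupOfPoints.

(** * Evaluation in the two bases *)

Section EvaluationProgram.
Variables (G : zmodType) (K : fieldType).
Hypothesis two_neq0 : (2 : K) != 0.
Variables (H : pred G) (x y : G -> K) (lam : G -> G -> K) (cst : K).
Hypothesis S : slope_system H x y lam cst.
Variables (m : nat) (t b : G).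
Local Notation d := (2 ^ m)%N.

(* Changes coordinates from the basis u or v to the functions [kernel lam t z]. *)
Definition to_kernel (kappa : nat -> K) (alpha beta : K) (c : nat -> K) (k : nat) : K :=
  if k == 0 then \sum_(i <- iota 0 d) kappa i * c i
  else alpha * c k + beta * c k.-1.

(** The change of coordinates costs 2 d operations for index 0 and at most 3 d for the others, on
    top of [slope_eval]. *)
Lemma kernel_program (kappa : nat -> K) (alpha beta : K) :
  (forall k, H (t *+ k) = (d %| k)%N) -> ~~ H (b *+ d) ->
  exists P : slp K, [/\ slp_ok d d P, (slp_cost P <= 14 * m * d + 5 * d)%N &
    forall inp, size inp = d -> forall l, (l < d)%N ->
      nth 0 (slp_run P inp) l = \sum_(0 <= k < d)
        to_kernel kappa alpha beta (nth 0 inp) k * kernel lam t (b + t *+ l) k].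
Proof.
move=> ordT hb; have d0 : (0 < d)%N by rewrite expn_gt0.
pose inK k (inp : seq K) := nth 0 inp k.
have hs : body_ok d ([::] : seq (operation K)) by [].
have [|s1 r1 A1] := reach_sum (n := d) (I := iota 0 d) (f := inK) kappa hs.
  by move=> i; rewrite mem_iota => /andP [_ hi]; exact: avail_input.
pose pre k inp := to_kernel kappa alpha beta (nth 0 inp) k.
have [s2 r2 A2] : exists2 s', reach d (d * 3) s1 s' &
    forall k, (k < d)%N -> avail d s' (pre k).
  apply: reach_family (reach_ok r1) _ => u q k ru hk.
  case: k hk => [|k] hk.
    exists u; first by apply: reachW (reach0 (reach_ok ru)).
    exact: (avail_reach ru).
  by apply: reach_lin2 (reach_ok ru) _ _; apply: avail_input => //; exact: ltnW.
have [s3 r3 A3] := slope_eval two_neq0 S ordT hb (reach_ok r2) A2.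
have /fin_all_exists [o oE] : forall l : 'I_d, exists o : operand K,
    operand_ok (d + size s3) o /\ forall inp, size inp = d ->
    operand_val (run s3 inp) o
    = \sum_(0 <= k < d) pre k inp * kernel lam t (b + t *+ l) k.
  by move=> l; have [o ho oE] := A3 l (ltn_ord l); exists o.
have [ok3 [s' s3E]] := reach_trans r1 (reach_trans r2 r3).
rewrite size_iota => cost3.
exists (Slp s3 [seq o l | l <- enum 'I_d]); split.
- apply/and3P; split; first exact: ok3.
    by rewrite all_map; apply/allP => l _; case: (oE l).
  by rewrite size_map -cardE card_ord.
- by rewrite /slp_cost /= s3E /=; lia.
- move=> inp sz l hl; rewrite /slp_run /= -map_comp.
  rewrite (nth_map (Ordinal hl)) -?cardE ?card_ord // /=.
  rewrite (nth_ord_enum (Ordinal hl) (Ordinal hl)).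
  by have [_ ->] := oE (Ordinal hl).
Qed.

End EvaluationProgram.

(** * Values of the basis functions on the coset of b *)

Section BasisValues.
Variables (K : fieldType) (E : weierstrass K) (disc0 : discriminant E != 0).
Hypothesis two_neq0 : (2 : K) != 0.
Local Notation EP := (epoint disc0).
Local Notation lam := (@ept_slope K E disc0).
Local Notation half_a1 := (2^-1 * a1 E).

Variables (m : nat) (t b : EP).
Hypothesis m0 : (0 < m)%N.
Local Notation d := (2 ^ m)%N.
Hypothesis ordT : forall k, (t *+ k == 0) = (d %| k)%N.
Hypothesis hb : b *+ d != 0.

Let S := ept_system disc0 two_neq0.

Lemma tMd k : t *+ k *+ d = 0.
Proof. by apply/eqP; rewrite -mulrnA ordT dvdn_mull. Qed.

(** This is how d b <> O is used: all translates of b by multiples of t have the same multiple by d,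
    so none of them is O. *)
Lemma coset_neq0 w : w *+ d = b *+ d -> w != 0.
Proof. by move=> e; apply: contraNneq hb => w0; rewrite -e w0 mul0rn. Qed.

Lemma tM_neq0 k : (0 < k < d)%N -> t *+ k != 0.
Proof.
case/andP=> k0 kd; rewrite ordT; apply/negP => /dvdn_leq.
by rewrite k0 leqNgt kd => /(_ isT).
Qed.

Section AtPoint.
Variable z : EP.
Hypothesis zd : z *+ d = b *+ d.

Lemma generic_coset P Q : P *+ d = b *+ d -> Q *+ d = 0 -> Q != 0 ->
  generic (pred1 0) P Q.
Proof.
move=> Pd Qd Q0; apply/and3P; split=> //=; first exact: coset_neq0.
by apply: coset_neq0; rewrite mulrnDl Qd addr0.
Qed.

(** The default 0 at k = 0 and k = d, where k t = O, lets the formula for u telescope around the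
    whole cycle. *)
Definition v_slope (k : nat) : K :=
  if (k == 0) || (k == d) then 0 else lam z (- (t *+ k)).
Definition u_offset (k : nat) : K :=
  if (k == 0) || (k == d.-1) then 0 else lam (- (t *+ k)) (- t).

(** The cocycle relation for z, - k t, - t. At the end k = d - 1 one has - k t = t, and
    [sys_lam_opp] takes its place. *)
Lemma u_slopeE k : (k < d)%N ->
  lam (z - t *+ k) (- t) = v_slope k.+1 - v_slope k + u_offset k.
Proof.
have d2 : (1 < d)%N by rewrite -[1%N](expn0 2) ltn_exp2l.
have ntd : (- t) *+ d = 0 by rewrite mulNrn -[t]mulr1n tMd oppr0.
have nt0 : - t != 0 by rewrite oppr_eq0 -[t]mulr1n tM_neq0.
move=> kd; have [->|k0] := eqVneq k 0%N.
  rewrite /v_slope /u_offset mulr0n subr0 eqxx /= ltn_eqF //.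
  by rewrite subr0 addr0 mulr1n.
have [kE|kd1] := eqVneq k d.-1.
  rewrite /v_slope /u_offset kE eqxx prednK ?expn_gt0 // eqxx !orbT.
  have -> : (d.-1 == 0)%N = false by move: d2; case: d => [|[|n]].
  have -> : (d.-1 == d)%N = false by move: d2; case: d => [|n] //= _; rewrite ltn_eqF.
  have -> : - (t *+ d.-1) = t.
    apply/esym/eqP; rewrite -subr_eq0 opprK -mulrS prednK ?expn_gt0 //.
    by rewrite ordT.
  rewrite /= sub0r addr0; apply: (sys_lam_opp S); apply: generic_coset => //.
    by rewrite -[t]mulr1n tMd.
  by rewrite -[t]mulr1n tM_neq0.
rewrite /v_slope /u_offset (negPf k0) (negPf kd1) (ltn_eqF kd) /=.
have k1d : (k.+1 < d)%N by rewrite ltn_neqAle kd andbT; apply: contraNneq kd1 => <-.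
rewrite (ltn_eqF k1d) mulrSr opprD.
have g1 : generic (pred1 0) z (- (t *+ k)).
  apply: generic_coset; rewrite ?mulNrn ?tMd ?oppr0 ?oppr_eq0 ?tM_neq0 //.
  by rewrite lt0n k0.
have g2 : generic (pred1 0) (- (t *+ k)) (- t).
  apply/and3P; split=> //=; first by rewrite oppr_eq0 tM_neq0 // lt0n k0.
  by rewrite -opprD oppr_eq0 -mulrSr tM_neq0.
have n3 : z - t *+ k - t != 0.
  by apply: coset_neq0; rewrite !mulrnDl ntd mulNrn tMd oppr0 !addr0.
rewrite -[LHS](addKr (lam z (- (t *+ k)))) (sys_cocycle S g1 g2 nt0 n3). ring.
Qed.

Lemma sum_u_slope :
  \sum_(0 <= k < d) (lam (z - t *+ k) (- t) - half_a1)
  = \sum_(0 <= k < d) (u_offset k - half_a1).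
Proof.
rewrite (eq_big_nat _ _ (F2 := fun k => v_slope k.+1 - v_slope k + (u_offset k - half_a1))).
  by rewrite big_split telescope_sumr // /v_slope !eqxx orbT /= subr0 add0r.
by move=> k /andP [_ kd]; rewrite u_slopeE // addrA.
Qed.

Lemma sum_v_basis (c : nat -> K) :
  \sum_(0 <= k < d) c k * (if k == 0 then 1 else lam z (- (t *+ k)) - half_a1)
  = \sum_(0 <= k < d)
      to_kernel m (fun k => if k == 0 then 1 else - half_a1) 1 0 c k * kernel lam t z k.
Proof.
have d0 : (0 < d)%N by rewrite expn_gt0.
rewrite !(big_ltn d0) {1}/to_kernel eqxx /kernel eqxx.
have -> : iota 0 d = index_iota 0 d by rewrite /index_iota subn0.
rewrite (big_ltn d0) /= !mulr1 mul1r -addrA; congr (_ + _).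
rewrite -big_split; apply: eq_big_nat => k /andP [k0 _].
by rewrite /to_kernel eqn0Ngt k0 /=; ring.
Qed.

(** Summation by parts in [u_slopeE]: the slope of index k receives c(k - 1) - c(k), and the
    boundary terms vanish by the defaults of [v_slope]. *)
Lemma sum_u_basis (c : nat -> K) (r : K) :
  \sum_(0 <= k < d) c k * (lam (z - t *+ k) (- t) + r)
  = \sum_(0 <= k < d)
      to_kernel m (fun k => u_offset k + r) (-1) 1 c k * kernel lam t z k.
Proof.
have d0 : (0 < d)%N by rewrite expn_gt0.
have shift : \sum_(0 <= k < d) c k * v_slope k.+1 = \sum_(1 <= k < d) c k.-1 * v_slope k.
  transitivity (\sum_(1 <= k < d.+1) c k.-1 * v_slope k); first by rewrite big_add1.
  by rewrite big_nat_recr //= {2}/v_slope eqxx orbT mulr0 addr0.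
rewrite (eq_big_nat _ _ (F2 := fun k => c k * v_slope k.+1
    + (- (c k * v_slope k) + (u_offset k + r) * c k))); last first.
  by move=> k /andP [_ kd]; rewrite u_slopeE //; ring.
rewrite !big_split /= shift [in RHS](big_ltn d0) {1}/to_kernel eqxx /kernel eqxx mulr1.
have -> : iota 0 d = index_iota 0 d by rewrite /index_iota subn0.
rewrite addrA addrC; congr (_ + _).
rewrite [\sum_(0 <= k < d) _](big_ltn d0) {2}/v_slope eqxx mulr0 oppr0 add0r.
rewrite -big_split; apply: eq_big_nat => k /andP [k0 kd].
by rewrite /to_kernel /v_slope eqn0Ngt k0 /= ltn_eqF //; ring.
Qed.

End AtPoint.
Section LocalBasis.
Variables (z : EP) (x y : K).
Hypotheses (zd : z *+ d = b *+ d) (zE : val z = Some (x, y)).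

Let zc : on_curve E (Some (x, y)).
Proof. by rewrite -zE; exact: (valP z). Qed.

Let model := funfield_model E.
Local Notation local := (local_value (fpoly E) (fy E) x y).

Lemma coset_addM_neq0 k : z + t *+ k != 0.
Proof. by apply: coset_neq0; rewrite mulrnDl tMd addr0. Qed.

Lemma coset_subM_neq0 k : z - t *+ k != 0.
Proof. by apply: coset_neq0; rewrite mulrnBl tMd subr0. Qed.

Lemma local_v_basis (k : 'I_d) : local (@v_basis K E (val t) d k)
  (if k == 0 :> nat then 1 else lam z (- (t *+ k)) - half_a1).
Proof.
rewrite /v_basis; have [_|k0] := eqVneq (k : nat) 0%N.
  have := local_const (fpoly E) (fy E) x y 1; rewrite polyC1.
  by rewrite (rmorph1 (fpoly E)).
have tk0 : t *+ k != 0 by rewrite tM_neq0 // lt0n k0 ltn_ord.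
rewrite -val_epointMn; have := local_u (A := 0) (B := t *+ k) zE.
rewrite !subr0 addr0 sub0r oppr_eq0 opprK; apply=> //.
- exact: coset_neq0.
- exact: coset_neq0.
- exact: coset_addM_neq0.
- exact: coset_subM_neq0.
Qed.

Lemma local_u_slope (k : nat) : (k < d)%N ->
  local (u_ E (pmul E k (val t)) (pmul E k.+1 (val t))) (lam (z - t *+ k) (- t) - half_a1).
Proof.
move=> kd; rewrite -!val_epointMn.
have tE : t *+ k - t *+ k.+1 = - t by rewrite mulrSr opprD addrA subrr add0r.
rewrite -tE; apply: (local_u zE).
- exact: coset_subM_neq0.
- exact: coset_addM_neq0.
- by rewrite tE oppr_eq0 -[t]mulr1n tM_neq0 //= -[1%N](expn0 2) ltn_exp2l.
- rewrite tE opprK; apply: coset_neq0.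
  by rewrite mulrnDl mulrnBl tMd subr0 -[t]mulr1n tMd addr0.
- exact: coset_subM_neq0.
Qed.

(** The constant (1 - a) / d of the basis u, with a evaluated by telescoping; it does not involve
    the point z. *)
Definition u_const : K :=
  (1 - \sum_(0 <= k < d) (u_offset k - half_a1)) / d%:R.

Lemma local_u_basis (k : 'I_d) : local (@u_basis K E (val t) d k)
  (lam (z - t *+ k) (- t) + (u_const - half_a1)).
Proof.
have -> : lam (z - t *+ k) (- t) + (u_const - half_a1)
  = lam (z - t *+ k) (- t) - half_a1 + u_const by rewrite addrA addrAC.
apply: (localD model zc); first exact: local_u_slope.
have local1 : local 1 1.
  have := local_const (fpoly E) (fy E) x y 1; rewrite polyC1.
  by rewrite (rmorph1 (fpoly E)).
have locald : local d%:R d%:R.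
  have := local_const (fpoly E) (fy E) x y d%:R; rewrite polyC_natr.
  by rewrite (rmorph_nat (fpoly E)).
rewrite /u_const -(sum_u_slope zd) big_mkord.
apply: (local_div model zc _ locald); last by rewrite natrX expf_neq0.
apply: (localB model zc local1); apply: (local_sum model zc) => i.
exact: local_u_slope.
Qed.

Lemma local_combination (w : 'I_d -> funfield E) (V : nat -> K) (c : d.-tuple K) :
  (forall k : 'I_d, local (w k) (V k)) ->
  local (\sum_(l < d) fconst E (tnth c l) * w l) (\sum_(0 <= k < d) nth 0 c k * V k).
Proof.
move=> hw; rewrite big_mkord; apply: (local_sum model zc) => i.
by rewrite (tnth_nth 0); apply: (localM model zc) => //; exact: local_const.
Qed.
End LocalBasis.

End BasisValues.

(** * The evaluation program and its cost *)

Lemma order_dvdn (K : fieldType) (E : weierstrass K) (disc0 : discriminant E != 0)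
    (t : epoint disc0) (d : nat) :
  has_order E (val t) d -> forall k, (t *+ k == 0) = (d %| k)%N.
Proof.
case=> d0 td tm k; have {}td : t *+ d = 0.
  by apply/eqP; rewrite -val_epoint_eq0 val_epointMn td.
rewrite {1}(divn_eq k d) mulrnDr mulnC mulrnA td mul0rn add0r.
apply/eqP/eqP => [tk|->]; last by rewrite mulr0n.
have [->//|r0] := posnP (k %% d).
have /tm [] : (0 < k %% d < d)%N by rewrite r0 ltn_pmod.
by rewrite -val_epointMn tk.
Qed.

Lemma odd_pchar_two_neq0 (K : fieldType) (p : nat) :
  p \in [pchar K] -> odd p -> (2 : K) != 0.
Proof.
move=> pK podd; rewrite -(dvdn_pcharf pK) (dvdn_prime2 (pcharf_prime pK)) //.
by apply: contraL podd => /eqP ->.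
Qed.

Theorem proposition3 (R : realType) :
  exists2 Q : R, 0 < Q &
  forall (K : fieldType) (p : nat), p \in [pchar K] -> odd p ->
  forall E : weierstrass K, discriminant E != 0 ->
  forall delta : nat, (1 <= delta)%N ->
  let d := (2 ^ delta)%N in
  forall t : point K, on_curve E t -> has_order E t d ->
  forall b : point K, on_curve E b -> pmul E d b <> None ->
  forall w : 'I_d -> funfield E,
    w = @u_basis K E t d \/ w = @v_basis K E t d ->
  exists P : slp K,
    [/\ slp_ok d d P,
        (slp_cost P)%:R <= Q * (d%:R * ln (d%:R : R)) &
        forall f : funfield E, riemann_roch (cyclic_divisor E t d) f ->
        forall c : d.-tuple K, f = \sum_(l < d) fconst E (tnth c l) * w l ->
        forall l : 'I_d,
          has_value idfun (padd E b (pmul E l t)) f (nth 0 (slp_run P c) l)].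
Proof.
have ln2 : 0 < ln (2 : R) by rewrite ln_gt0 // ltr1n.
(* With ln d = delta ln 2, the bound reads 19 delta d. It dominates the cost 14 delta d + 5 d
   because delta >= 1. *)
exists (19 / ln 2); first by rewrite divr_gt0 // ltr0n.
move=> K p pK podd E disc0 delta delta0 d t tE ordt b bE hb w hw.
have two_neq0 := odd_pchar_two_neq0 pK podd.
pose t' : epoint disc0 := exist _ t tE; pose b' : epoint disc0 := exist _ b bE.
have ordT := order_dvdn (t := t') ordt.
have hb' : b' *+ d != 0 by rewrite -val_epoint_eq0 val_epointMn; apply/eqP.
have S := ept_system disc0 two_neq0.
have coset l : (b' + t' *+ l) *+ d = b' *+ d by rewrite mulrnDl (tMd ordT) addr0.
(* Both bases reduce to [to_kernel], with parameters independent of the evaluation point and of the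
   input, hence admissible as precomputed constants. *)
have [kappa [alpha [beta hval]]] : exists kappa alpha beta,
    forall z x y, z *+ d = b' *+ d -> val z = Some (x, y) -> forall c : d.-tuple K,
    local_value (fpoly E) (fy E) x y (\sum_(l < d) fconst E (tnth c l) * w l)
      (\sum_(0 <= k < d) to_kernel delta kappa alpha beta (nth 0 c) k
         * kernel (@ept_slope K E disc0) t' z k).
  case: hw => ->.
    exists (fun k => u_offset delta t' k + (u_const delta t' - 2^-1 * a1 E)), (-1), 1.
    move=> z x y zd zE c; rewrite -(sum_u_basis two_neq0 delta0 ordT hb' zd).
    apply: (local_combination zE) => k.
    exact: (local_u_basis two_neq0 delta0 ordT hb' zd zE).
  exists (fun k => if k == 0 then 1 else - (2^-1 * a1 E)), 1, 0.
  move=> z x y zd zE c; rewrite -sum_v_basis.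
  apply: (local_combination zE) => k.
  exact: (local_v_basis ordT hb' zd zE).
have [P [Pok Pcost Pval]] := kernel_program two_neq0 S kappa alpha beta ordT hb'.
exists P; split=> //.
  have -> : 19 / ln 2 * (d%:R * ln d%:R) = (19 * delta * 2 ^ delta)%:R :> R.
    rewrite !natrM natrX lnXn ?ltr0n // -mulr_natl.
    by field; rewrite gt_eqF.
  rewrite ler_nat; apply: leq_trans Pcost _; move: delta0; clear.
  by case: delta => // n _; nia.
move=> f _ c -> l; rewrite Pval ?size_tuple //.
have [x [y zE]] := epoint_neq0 (coset_neq0 hb' (coset l)).
have -> : padd E b (pmul E l t) = Some (x, y) by rewrite -zE val_epointD val_epointMn.
by apply: has_value_of_local; exact: hval (coset l) zE c.
Qed.
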